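(* Let $(E,B,p,\Gamma)$ be a compact graph bundle, let $F:E\to E$ and $f:B\to B$ be continuous maps with $p\circ F=f\circ p$, and assume $(B,f)$ is minimal. Let $M\subseteq E$ be a minimal set of $F$ with $p(M)=B$. Then exactly one of the following two mutually exclusive possibilities occurs: (A1) $\overline{\operatorname{End}(M)}=M$; moreover this holds if and only if $M$ is nowhere dense in $E$; (A2) $\operatorname{End}(M)=\emptyset$; moreover this holds if and only if $M$ has nonempty interior in $E$. In particular, if $\Gamma$ is a tree, then every such minimal set $M$ is nowhere dense in $E$.
   Context: A graph is a nonempty compact metric space which is the union of finitely many arcs, any two of which are either disjoint or intersect only in one or both of their end-points (a graph need not be connected; a singleton is not a graph). A circle is a simple closed curve; a tree is a graph containing no circle. For a point $x$ of a graph $G$, $\operatorname{ord}(x,G)$ is the number of arcs emanating from $x$; points of order $1$ are end-points, points of order $\ge 3$ are ramification points. For $n\ge1$ the $n$-star $S_n=\{z\in\mathbb C: z^n\in[0,1]\}$ (or any homeomorphic copy) has central point $0$; the open $n$-star $\Sigma_n$ is $S_n$ with its $n$ end-points removed. A compact graph bundle $(E,B,p,\Gamma)$ consists of compact metric spaces $E,B$, a graph $\Gamma$ and a continuous surjection $p:E\to B$ such that every $b\in B$ has an open neighbourhood $U$ (a trivializing neighbourhood) and a homeomorphism $h:p^{-1}(U)\to U\times\Gamma$ with $\mathrm{pr}_1\circ h=p$ (a canonical homeomorphism). For $M\subseteq E$ and $b\in B$, $M_b=M\cap p^{-1}(b)$, and $\Gamma_b=p^{-1}(b)$ (a graph homeomorphic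 to $\Gamma$). A continuous selfmap $g$ of a compact metric space $X$ is minimal if $X$ has no proper nonempty closed subset $A$ with $g(A)\subseteq A$ (equivalently, every forward orbit is dense). A minimal set of $g$ is a nonempty closed set $M$ with $g(M)\subseteq M$ such that $g|_M$ is minimal. Let $Z$ be a closed subset of a graph $\Gamma'$. A point $x\in Z$ is a star-like interior point of $Z$ if some $Z$-open neighbourhood of $x$ is homeomorphic to $\Sigma_k$ for some $k\ge2$ by a homeomorphism sending $x$ to the central point; otherwise $x$ is an end-point of $Z$; $\operatorname{End}(Z)$ denotes the set of end-points of $Z$. For a closed set $M$ in a compact graph bundle, $\operatorname{End}(M)=\bigcup_{b\in B}\operatorname{End}(M_b)$, where $M_b$ is regarded as a closed subset of the graph $\Gamma_b$. *)

(* Defs.v *)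
From HB Require Import structures.
From mathcomp Require Import all_boot all_order all_algebra.
From mathcomp Require Import all_classical all_reals all_analysis.
Set Implicit Arguments. Unset Strict Implicit. Unset Printing Implicit Defensive.
Import Order.TTheory GRing.Theory Num.Theory.
Import numFieldNormedType.Exports.
Local Open Scope classical_set_scope.
Local Open Scope ring_scope.

Section Defs.
Variable R : realType.

Definition compact_metric (X : pseudoMetricType R) :=
  hausdorff_space X /\ compact [set: X].

Definition homeo_on {X Y : topologicalType} (A : set X) (C : set Y) (h : X -> Y) :=
  exists k : Y -> X,
    [/\ {within A, continuous h}, {within C, continuous k},
        (forall x, A x -> C (h x) /\ k (h x) = x) &
        (forall y, C y -> A (k y) /\ h (k y) = y)].

Definition I01 : set R := [set t : R | 0 <= t <= 1].

Definition arc_param {X : topologicalType} (g : R -> X) :=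
  homeo_on I01 (g @` I01) g.

Definition is_graph (G : pseudoMetricType R) :=
  compact_metric G /\
  exists (n : nat) (g : 'I_n -> R -> G),
    [/\ (0 < n)%N,
        (forall i, arc_param (g i)),
        [set: G] = \bigcup_(i in [set: 'I_n]) (g i @` I01) &
        (forall i j, i != j ->
           (g i @` I01) `&` (g j @` I01)
           `<=` [set g i 0; g i 1] `&` [set g j 0; g j 1])].

Definition unit_circle : set (R * R) := [set z | z.1 ^+ 2 + z.2 ^+ 2 = 1].

Definition is_circle {X : topologicalType} (C : set X) :=
  exists h : X -> R * R, homeo_on C unit_circle h.

Definition is_tree (G : pseudoMetricType R) :=
  is_graph G /\ ~ exists C : set G, is_circle C.

(* the open n-star Sigma_n = {z in C : z^n in [0,1)} seen in R^2 = C: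
   the points t e^{2 pi i j / n} with 0 <= t < 1, j < n; central point 0 *)
Definition open_star (n : nat) : set (R * R) :=
  [set z | exists (j : nat) (t : R), [/\ (j < n)%N, 0 <= t, t < 1 &
     z = (t * cos (2 * pi * j%:R / n%:R), t * sin (2 * pi * j%:R / n%:R))]].

Definition graph_bundle (E B G : pseudoMetricType R) (p : E -> B) :=
  [/\ compact_metric E /\ compact_metric B, is_graph G,
      continuous p, (forall b, exists x, p x = b) &
      forall b : B, exists U : set B, [/\ open U, U b &
        exists h : E -> B * G,
          homeo_on (p @^-1` U) (U `*` [set: G]) h /\
          (forall x, U (p x) -> (h x).1 = p x)]].

Definition minimal_map {X : topologicalType} (g : X -> X) :=
  forall A : set X, closed A -> A !=set0 -> g @` A `<=` A -> A = [set: X].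

Definition minimal_set {X : topologicalType} (g : X -> X) (M : set X) :=
  [/\ closed M, M !=set0, g @` M `<=` M &
      forall A : set X, closed A -> A !=set0 -> A `<=` M -> g @` A `<=` A -> A = M].

(* x is a star-like interior point of Z (Z carries the subspace topology of
   the ambient space, the same as the one inherited from the fibre graph) *)
Definition star_interior {X : topologicalType} (Z : set X) (x : X) :=
  Z x /\ exists O : set X, [/\ open O, O x &
    exists n : nat, (2 <= n)%N /\
      exists h : X -> R * R, homeo_on (Z `&` O) (open_star n) h /\ h x = (0, 0)].

(* End(M) = union over b of End(M_b), M_b = M ∩ p^{-1}(b) *)
Definition End_set {E B : topologicalType} (p : E -> B) (M : set E) : set E :=
  [set x | M x /\ ~ star_interior (M `&` p @^-1` [set p x]) x].

Definition nowhere_dense {X : topologicalType} (A : set X) :=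
  interior (closure A) = set0.

End Defs.

(* Main.v *)
Require Import Defs.
From HB Require Import structures.
From mathcomp Require Import all_boot all_order all_algebra.
From mathcomp Require Import all_classical all_reals all_analysis.
From mathcomp Require Import ring lra.
Set Implicit Arguments. Unset Strict Implicit. Unset Printing Implicit Defensive.
Import Order.TTheory GRing.Theory Num.Theory.
Import numFieldNormedType.Exports.
Local Open Scope classical_set_scope.
Local Open Scope ring_scope.

(* A minimal map is irreducible: no proper closed subset of M has image M under an
   iterate of F, so no open piece of M can be covered twice by an iterate of F.

   Suppose M has nonempty interior. It contains a box V x J with J a subarc of an
   edge, and every point of M is hit from this box in boundedly many steps. By Baire,
   over generic base points no iterate collapses a subarc of the box, and
   irreducibility forbids folding; so every point of a generic fibre of M is crossed
   by a path of that fibre which does not stay on one side of the point. Hence the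
   fibre is a union of full edges in which each vertex lies on at least two edges.
   There are only finitely many sets of edges, so this passes to the limit in every
   fibre. Such a fibre has no end-points, and following its edges until a vertex
   repeats produces a circle.

   Conversely, if some relatively open part of M consists of star-like interior
   points, then all fibres over a nonempty open subset of B contain a subarc of an
   edge with rational parameters, and Baire produces an interior point of M. *)

(** * Minimal maps of compact spaces *)

Section Topology.

(** [F] may send the fibre of [M] over [b] to a proper part of the fibre over [f b], and not
    injectively, so irreducibility is available only on [M] as a whole. To contradict it, an open
    piece must be deleted over a whole neighbourhood of base points; this is why folding and
    collapsing are refuted on a product box and not on one arc. A fold over one base point persists
    nearby, so folding is excluded over every base point of the box. A collapse need not persist, so
    it is excluded only off a meagre set. Irreducibility of [f] has two further uses: iterates of
    [f] keep closed nowhere dense sets nowhere dense, so genericity can be imposed on the target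
    fibre; and [p] restricted to [M] sends nonempty relatively open sets to sets with interior, so
    generic fibres are dense in [M]. In the limit an edge set must be fixed first: full edges
    survive limits because [M] is closed, but the second edge at a vertex could vary with the
    fibre. *)

Lemma regular_shrink (X : uniformType) (U : set X) (x : X) : open U -> U x ->
  exists V : set X, [/\ open V, V x & closure V `<=` U].
Proof.
move=> oU Ux; have [V Vx VU] := uniform_regular (open_nbhs_nbhs (conj oU Ux)).
exists V°; split; [exact: open_interior|exact: Vx|].
by apply: subset_trans VU; apply: closureS; exact: interior_subset.
Qed.

Lemma image_closed (X Y : topologicalType) (f : X -> Y) (A : set X) :
  compact [set: X] -> hausdorff_space Y -> continuous f -> closed A ->
  closed (f @` A).
Proof.
move=> cX hY cf cA; apply: compact_closed => //; apply: continuous_compact.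
  exact: continuous_subspaceT.
exact: (subclosed_compact cA cX).
Qed.

Lemma nested_closed (X : topologicalType) (A : (set X)^nat) :
  compact [set: X] -> (forall n, closed (A n)) -> (forall n, A n !=set0) ->
  (forall n, A n.+1 `<=` A n) -> exists x, forall n, A n x.
Proof.
move=> cX cA nA dA.
have dA' m n : (m <= n)%N -> A n `<=` A m.
  move=> /subnK <-; elim: (n - m)%N => // k IH.
  by apply: subset_trans IH; exact: dA.
have [x [_ clx]] : [set: X] `&` cluster (filter_from [set: nat] A) !=set0.
  apply: cX; last by exists 0%N.
  apply: filter_from_proper => [|n _]; last exact: nA.
  apply: filter_from_filter => [|i j _ _]; first by exists 0%N.
  exists (maxn i j) => // y Ay.
  by split; [apply: dA' Ay; exact: leq_maxl|apply: dA' Ay; exact: leq_maxr].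
exists x => n; apply: (cA n) => V Vx; apply: clx => //; by exists n.
Qed.

(** Regularity and compactness take the place of a complete metric: nested nonempty closed sets
    share a point whatever their size. *)
Lemma baire_compact (X : uniformType) (N : (set X)^nat) (U : set X) :
  compact [set: X] -> (forall n, closed (N n)) -> (forall n, (N n)° = set0) ->
  open U -> U !=set0 -> exists x, U x /\ forall n, ~ N n x.
Proof.
move=> cX cN iN oU [u0 Uu0].
have step (n : nat) (V : set X) : open V -> V !=set0 ->
    exists W : set X, [/\ open W, W !=set0, closure W `<=` V & closure W `<=` ~` N n].
  move=> oV [v Vv].
  have oVN : open (V `&` ~` N n) by apply: openI => //; exact: closed_openC.
  have [x VNx] : V `&` ~` N n !=set0.
    apply: contrapT => VN0.
    suff : (N n)° v by rewrite iN.
    rewrite /interior nbhsE; exists V => // w Vw.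
    by apply: contrapT => nNw; apply: VN0; exists w.
  have [W [oW Wx cW]] := regular_shrink oVN VNx.
  by exists W; split => //; [exists x|move=> y /cW []|move=> y /cW []].
pose P (V : set X) := open V /\ V !=set0.
pose Q (n : nat) (V W : set X) := P V ->
  P W /\ (closure W `<=` V /\ closure W `<=` ~` N n).
have /choice [g gP] : forall nV : nat * set X, exists W, Q nV.1 nV.2 W.
  move=> [n V] /=; have [PV|nPV] := pselect (P V); last by exists V.
  by have [W [? ? ? ?]] := step n V PV.1 PV.2; exists W.
pose V := fix V (n : nat) : set X := if n is m.+1 then g (m, V m) else U.
have PV n : P (V n) by elim: n => [|n IH]; [split => //; exists u0|have [] :=
  gP (n, V n) IH].
have [x Ax] : exists x, forall n, closure (V n.+1) x.
  apply: nested_closed => // [n|n|n].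
  - exact: closed_closure.
  - by have [_ [y Vy]] := PV n.+1; exists y; exact: subset_closure.
  - have [_ [cV _]] := gP (n.+1, V n.+1) (PV n.+1).
    by apply: subset_trans cV _; exact: subset_closure.
exists x; split.
  by have [_ [cV _]] := gP (0%N, V 0%N) (PV 0%N); apply: cV; exact: Ax.
by move=> n; have [_ [_ cV]] := gP (n, V n) (PV n); apply: cV; exact: Ax.
Qed.

Lemma baire_countable (X : uniformType) (I : countType) (N : I -> set X) (U : set X) :
  compact [set: X] -> (forall i, closed (N i)) -> (forall i, (N i)° = set0) ->
  open U -> U !=set0 -> exists x, U x /\ forall i, ~ N i x.
Proof.
move=> cX cN iN.
pose N' n := if unpickle n is Some i then N i else set0.
have cN' n : closed (N' n) by rewrite /N'; case: (unpickle n) => [i|];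
  [exact: cN|exact: closed0].
have iN' n : (N' n)° = set0 by rewrite /N'; case: (unpickle n) => [i|];
  [exact: iN|exact: interior0].
move=> oU U0; have [x [Ux Nx]] := baire_compact cX cN' iN' oU U0.
by exists x; split => // i; have := Nx (pickle i); rewrite /N' pickleK.
Qed.

Lemma pair_continuous (X Y Z : topologicalType) (u : X -> Y) (v : X -> Z) x :
  {for x, continuous u} -> {for x, continuous v} ->
  {for x, continuous (fun t => (u t, v t))}.
Proof. by move=> cu cv; apply: (cvg_pair cu cv). Qed.

Lemma within_continuous_comp_in (X Y Z : topologicalType) (A : set Y) (u : X -> Y)
  (v : Y -> Z) :
  {within A, continuous v} -> continuous u -> (forall x, A (u x)) ->
  continuous (v \o u).
Proof.
move=> /subspace_continuousP cv cu Au x W /(cv _ (Au x)) nW.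
have nx : nbhs x (u @^-1` [set y | A y -> W (v y)]) by exact: (cu x _ nW).
by apply: (@filterS _ (nbhs x)) nx => x' /=; apply; exact: Au.
Qed.

End Topology.

(** * Trapped orbits, bounded visiting times, irreducibility *)

Section Dynamics.
Variables (X : uniformType) (g : X -> X) (M : set X).
Hypotheses (cX : compact [set: X]) (hX : hausdorff_space X).
Hypotheses (cg : continuous g) (mM : minimal_set g M).

Lemma iter_continuous n : continuous (iter n g).
Proof.
elim: n => [|n IH] x; first exact: cvg_id.
by apply: continuous_comp; [exact: IH|exact: cg].
Qed.

Lemma minimal_iter n x : M x -> M (iter n g x).
Proof.
have [_ _ gM _] := mM.
by move=> Mx; elim: n => //= n IH; apply: gM; exists (iter n g x).
Qed.

Lemma minimal_onto : g @` M = M.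
Proof.
have [cM [x Mx] gM minM] := mM; apply: minM => //.
- exact: image_closed.
- by exists (g x); exists x.
- by move=> _ [y gMy <-]; exists y => //; exact: gM.
Qed.

Lemma minimal_iter_onto n y : M y -> exists2 x, M x & iter n g x = y.
Proof.
elim: n y => [|n IH] y My; first by exists y.
move: My; rewrite -{1}minimal_onto => -[z Mz <-].
by have [x Mx <-] := IH z Mz; exists x.
Qed.

(** By compactness, arbitrarily long orbit pieces in [A] yield a full forward orbit in [A]; its
    closure is invariant, hence [M]. Bounded visiting times and irreducibility both reduce to
    this. *)
Lemma minimal_trapped (A : set X) : closed A -> A `<=` M ->
  (forall n, exists x, forall i, (i <= n)%N -> A (iter i g x)) -> A = M.
Proof.
move=> cA AM trap; have [cM _ _ minM] := mM.
have [x Ax] : exists x, forall n, (fun n => [set x | forall i, (i <= n)%N ->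
  A (iter i g x)]) n x.
  apply: nested_closed => // [n|n y Ay i iln]; last by apply: Ay; exact: leqW.
  rewrite [X in closed X](_ : _ = \bigcap_(i in [set i | (i <= n)%N])
    (iter i g @^-1` A)).
    apply: closed_bigI => i _; apply: preimage_closed => // y _; exact: iter_continuous.
  by apply/seteqP; split => y.
have Ax' n : A (iter n g x) by exact: (Ax n n (leqnn n)).
pose C := closure [set iter n g x | n in [set: nat]].
have CA : C `<=` A.
  by move=> y Cy; apply: cA; apply: closureS Cy => _ [n _ <-]; exact: Ax'.
apply/seteqP; split=> //; suff <- : C = M by exact: CA.
apply: minM.
- exact: closed_closure.
- by exists x; apply: subset_closure; exists 0%N.
- exact: subset_trans CA AM.
- move=> _ [y Cy <-] V Vgy.
  have [_ [[n _ <-] Vn]] := Cy _ (cg Vgy).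
  by exists (iter n.+1 g x); split => //; exists n.+1.
Qed.

(** Without a common bound, arbitrarily long orbit pieces would avoid [U], and trapping would put
    all of [M] outside [U]. *)
Lemma minimal_visit (U : set X) : open U -> M `&` U !=set0 ->
  exists N, forall x, M x -> exists2 k, (k <= N)%N & U (iter k g x).
Proof.
move=> oU [u [Mu Uu]]; apply: contrapT => noN.
have cM : closed M by have [] := mM.
suff MU : M `&` ~` U = M by have := Mu; rewrite -MU => -[].
apply: minimal_trapped => [|? []//|n].
  by apply: closedI => //; exact: open_closedC.
apply: contrapT => nx; apply: noN; exists n => x Mx.
apply: contrapT => nk; apply: nx; exists x => i iln; split; first exact: minimal_iter.
by move=> Ui; apply: nk; exists i.
Qed.

(** Each point of [A] has a preimage in [A], so backward orbits of any length can be built inside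
    [A]; read forwards, they are the long pieces that trapping asks for. *)
Lemma minimal_irreducible (A : set X) : closed A -> A `<=` M -> M `<=` g @` A -> A = M.
Proof.
move=> cA AM MgA; apply: minimal_trapped => // n.
have [_ [m Mm] _ _] := mM.
suff : exists x, iter n.+1 g x = m /\ forall i, (i <= n)%N -> A (iter i g x).
  by move=> [x [_ ?]]; exists x.
have [x0 [Ax0 x0m]] : exists x0, A x0 /\ g x0 = m by have [x ? ?] := MgA _ Mm; exists x.
elim: n m Mm x0 Ax0 x0m => [|n IH] m Mm x0 Ax0 x0m.
  by exists x0; split => // i; rewrite leqn0 => /eqP ->.
have [x1 Ax1 x1m] := MgA _ (AM _ Ax0).
have [x [xm Ax]] := IH x0 (AM _ Ax0) x1 Ax1 x1m.
exists x; split; first by rewrite iterS xm.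
move=> i; rewrite leq_eqVlt => /predU1P[->|]; last exact: Ax.
by rewrite xm.
Qed.

(** The [k]-th image of [A] is closed and its image under [g] covers [M]; the one-step case makes it
    all of [M], and the induction descends to [A]. *)
Lemma minimal_irreducible_iter k (A : set X) :
  closed A -> A `<=` M -> M `<=` iter k g @` A -> A = M.
Proof.
elim: k A => [|k IH] A cA AM MA.
  by apply/seteqP; split => // x /MA [y Ay <-].
apply: IH => //; suff -> : iter k g @` A = M by [].
apply: minimal_irreducible.
- by apply: image_closed => //; exact: iter_continuous.
- by move=> _ [x /AM Mx <-]; exact: minimal_iter.
- by move=> y /MA [x Ax <-]; exists (iter k g x) => //; exists x.
Qed.

End Dynamics.

(** * Images of open sets and of nowhere dense sets *)

Section MinimalMap.
Variables (X : uniformType) (g : X -> X).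
Hypotheses (cX : compact [set: X]) (hX : hausdorff_space X).
Hypotheses (cg : continuous g) (mg : minimal_set g [set: X]).

(** [W] consists of the points all of whose [k]-th preimages lie in [U]; were it empty, the
    complement of [U] would still map onto the space. *)
Lemma minimal_feebly_open k (U : set X) : open U -> U !=set0 ->
  exists W : set X, [/\ open W, W !=set0 & W `<=` iter k g @` U].
Proof.
move=> oU [u Uu]; exists (~` (iter k g @` (~` U))); split.
- apply: closed_openC; apply: image_closed => //; first exact: iter_continuous.
  exact: open_closedC.
- apply: contrapT => W0.
  suff nU : ~` U = [set: X] by have : (~` U) u by rewrite nU.
  apply: (minimal_irreducible_iter cX hX cg mg (k := k)) => //.
    exact: open_closedC.
  by move=> y _; apply: contrapT => nA; apply: W0; exists y.
- move=> y ny; have [x _ xy] := minimal_iter_onto cX hX cg mg k (I : setT y).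
  by exists x => //; apply: contrapT => nUx; apply: ny; exists x.
Qed.

(** If an open [W] lay in the image, [C] together with the points not sent into [W] would map onto
    the space, hence be the space, and [C] would contain the open preimage of [W]. *)
Lemma minimal_image_interior k (C : set X) : closed C -> C° = set0 ->
  (iter k g @` C)° = set0.
Proof.
move=> cC iC; rewrite -subset0 => w; rewrite /interior nbhsE => -[W [oW Ww] WC].
have cW : closed (C `|` iter k g @^-1` (~` W)).
  apply: closedU => //; apply: preimage_closed => [x _|]; first exact: iter_continuous.
  exact: open_closedC.
have CT : C `|` iter k g @^-1` (~` W) = [set: X].
  apply: (minimal_irreducible_iter cX hX cg mg (k := k)) => // y _.
  have [Wy|nWy] := pselect (W y).
    by have [x Cx xy] := WC y Wy; exists x => //; left.
  have [x _ xy] := minimal_iter_onto cX hX cg mg k (I : setT y).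
  by exists x => //; right; rewrite /= xy.
have [x _ xw] := minimal_iter_onto cX hX cg mg k (I : setT w).
have : C° x; last by rewrite iC.
rewrite /interior nbhsE; exists (iter k g @^-1` W).
  split; last by rewrite /= xw.
  by apply: open_comp => // z _; exact: iter_continuous.
by move=> z /= Wz; have : [set: X] z by []; rewrite -CT => -[].
Qed.

End MinimalMap.

(** * Semi-openness of the projection on [M] *)

Section Factor.
Variables (E B : uniformType) (p : E -> B) (F : E -> E) (f : B -> B) (M : set E).
Hypotheses (cE : compact [set: E]) (hE : hausdorff_space E).
Hypotheses (cB : compact [set: B]) (hB : hausdorff_space B).
Hypotheses (cp : continuous p) (cF : continuous F) (cf : continuous f).
Hypotheses (pF : forall x, p (F x) = f (p x)).
Hypotheses (mf : minimal_set f [set: B]) (mM : minimal_set F M).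
Hypothesis pM : p @` M = [set: B].

Lemma iter_factor n x : p (iter n F x) = iter n f (p x).
Proof. by elim: n => //= n IH; rewrite pF IH. Qed.

(** Every orbit in [M] enters [W'], so the preimages of the closed set [C] under iterates of [f]
    cover the base; by Baire one of them has interior, and feeble openness carries an open set from
    there into [C]. *)
Lemma factor_semiopen (W : set E) : open W -> M `&` W !=set0 ->
  exists V : set B, [/\ open V, V !=set0 & V `<=` p @` (M `&` W)].
Proof.
move=> oW [x [Mx Wx]]; have [W' [oW' W'x cW']] := regular_shrink oW Wx.
have [N HN] := minimal_visit cE cF mM oW' (ex_intro _ x (conj Mx W'x)).
pose C := p @` (M `&` closure W').
have cC : closed C.
  by apply: image_closed => //; apply: closedI; [case: mM|exact: closed_closure].
have [k [b nb]] : exists k, (iter k f @^-1` C)° !=set0.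
  apply: contrapT => nk.
  have cN n : closed (iter n f @^-1` C).
    by apply: preimage_closed => // y _; exact: iter_continuous.
  have iN n : (iter n f @^-1` C)° = set0.
    by apply/eqP/negPn/negP => /set0P ne; apply: nk; exists n.
  have [b [_ nb]] := baire_compact cB cN iN openT (ex_intro _ (p x) I).
  have [z Mz zb] : (p @` M) b by rewrite pM.
  have [k _ Wk] := HN z Mz; apply: (nb k); exists (iter k F z); last first.
    by rewrite iter_factor zb.
  by split; [exact: minimal_iter|exact: subset_closure].
have [V [oV V0 VC]] := minimal_feebly_open cB hB cf mf k (open_interior _)
  (ex_intro _ b nb).
exists V; split => // v /VC [c /interior_subset /= [y [My Wy] <-] <-].
by exists y => //; split => //; exact: cW'.
Qed.

End Factor.

(** * Graphs as unions of edges *)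

Section Edges.
Variables (R : realType) (G : topologicalType).
Hypothesis hG : hausdorff_space G.
Implicit Types (gm : R -> G) (a b c t : R).

(** Continuity on all of [R] avoids subspace topologies; openness of the open arc encodes that the
    rest of the graph is attached at its ends only. A bare parametrization, not an index, is used so
    that an edge can be reversed. *)
Definition edge gm :=
  [/\ continuous gm,
      (forall s t, 0 <= s <= 1 -> 0 <= t <= 1 -> gm s = gm t -> s = t) &
      open (gm @` `]0, 1[)].

Lemma path_closed gm a b : continuous gm -> closed (gm @` `[a, b]).
Proof.
move=> cg; apply: compact_closed => //; apply: continuous_compact.
  exact: continuous_subspaceT.
exact: segment_compact.
Qed.

Lemma edge_open gm a b : edge gm -> 0 <= a -> b <= 1 -> open (gm @` `]a, b[).
Proof.
move=> [cg ig og] a0 b1.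
rewrite [X in open X](_ : _ = gm @` `]0, 1[ `&`
    (~` (gm @` `[0, a]) `&` ~` (gm @` `[b, 1]))).
  by apply: openI => //; apply: openI; apply: closed_openC; exact: path_closed.
apply/seteqP; split => [x [t /=]|x [[t /=]]].
  rewrite in_itv /= => tab <-; split; [|split].
  - exists t => //=; rewrite in_itv /=; lra.
  - move=> [s /=]; rewrite in_itv /= => sa /ig st.
    by have {}st : s = t by [apply: st; lra]; lra.
  - move=> [s /=]; rewrite in_itv /= => sa /ig st.
    by have {}st : s = t by [apply: st; lra]; lra.
rewrite in_itv /= => t01 <- [nA nB]; exists t => //=; rewrite in_itv /=.
apply/andP; split; rewrite ltNge; apply/negP => h.
  by apply: nA; exists t => //=; rewrite in_itv /=; lra.
by apply: nB; exists t => //=; rewrite in_itv /=; lra.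
Qed.

Lemma edge_rev gm : edge gm -> edge (fun t => gm (1 - t)).
Proof.
move=> [cg ig og]; split.
- move=> t; apply: continuous_comp; last exact: cg.
  by apply: cvgB; [exact: cvg_cst|exact: cvg_id].
- by move=> s t s01 t01 /ig st; have {}st : 1 - s = 1 - t by [apply: st; lra]; lra.
- rewrite [X in open X](_ : _ = gm @` `]0, 1[) //.
  apply/seteqP; split => x [t /=]; rewrite in_itv /= => t01 <-.
    by exists (1 - t) => //=; rewrite in_itv /=; lra.
  by exists (1 - t) => /=; [rewrite in_itv /=; lra|rewrite opprB addrC subrK].
Qed.

Definition edge_coord gm (x : G) : R := xget 0 [set t | 0 <= t <= 1 /\ gm t = x].

Lemma edge_coordK gm t : edge gm -> 0 <= t <= 1 -> edge_coord gm (gm t) = t.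
Proof.
move=> [_ ig _] t01; rewrite /edge_coord.
by case: xgetP => [s _ [s01 /ig]|/(_ t)]; [exact|case].
Qed.

Lemma edge_coord_cvg gm t : edge gm -> 0 < t < 1 -> {for gm t,
  continuous (edge_coord gm)}.
Proof.
move=> eg t01; apply/cvgrPdist_lt => e e0.
rewrite edge_coordK //; last by lra.
pose a := Num.max 0 (t - e); pose b := Num.min 1 (t + e).
have a0 : 0 <= a by rewrite le_max lexx.
have b1 : b <= 1 by rewrite ge_min lexx.
have oU := edge_open eg a0 b1.
have nU : nbhs (gm t) (gm @` `]a, b[).
  apply: open_nbhs_nbhs; split => //; exists t => //=.
  by rewrite in_itv /= gt_max lt_min; lra.
apply: filterS nU => y [s /=]; rewrite in_itv /= gt_max lt_min => sab <-.
by rewrite /= edge_coordK // ?ltr_distl; lra.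
Qed.

Definition edge_fun gm (phi : R -> R) (x : G) : R :=
  if x \in gm @` `]0, 1[ then phi (edge_coord gm x) else 0.

Lemma edge_funE gm (phi : R -> R) t : edge gm -> phi 0 = 0 -> phi 1 = 0 -> 0 <=
  t <= 1 ->
  edge_fun gm phi (gm t) = phi t.
Proof.
move=> eg p0 p1 t01; rewrite /edge_fun; case: ifPn => [_|];
  first by rewrite edge_coordK.
rewrite notin_setE => nt.
have [->//|t0] := eqVneq t 0; have [->//|t1] := eqVneq t 1.
by exfalso; apply: nt; exists t => //=; rewrite in_itv /=; lra.
Qed.

(** The preimage of a closed [D] is the compact image of a set of parameters, with the complement of
    the open edge added exactly when [D] contains [0]. *)
Lemma edge_fun_continuous gm (phi : R -> R) : edge gm -> continuous phi ->
  phi 0 = 0 -> phi 1 = 0 -> continuous (edge_fun gm phi).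
Proof.
move=> eg cphi p0 p1; apply/continuous_closedP => D cD.
have cA : closed (gm @` (`[0, 1] `&` phi @^-1` D)).
  apply: compact_closed => //; apply: continuous_compact.
    by apply: continuous_subspaceT; case: eg.
  apply: compact_closedI; first exact: segment_compact.
  by apply: preimage_closed => // x _; exact: cphi.
have cO : closed (~` (gm @` `]0, 1[)) by apply: open_closedC; case: eg.
have [D0|nD0] := pselect (D 0).
  rewrite [X in closed X](_ : _ = gm @` (`[0, 1] `&` phi @^-1` D)
    `|` ~` (gm @` `]0, 1[)).
    exact: closedU.
  apply/seteqP; split => [x /= Dx|x /= [[t [/= t01 Dt] <-]|nx]].
  - have [[t /=]|] := pselect ((gm @` `]0, 1[) x); last by right.
    rewrite in_itv /= => t01 tx; left; exists t => //; split => /=.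
      by rewrite in_itv /=; lra.
    by move: Dx; rewrite -tx edge_funE //; lra.
  - by rewrite edge_funE //; move: t01; rewrite in_itv.
  - by rewrite /edge_fun memNset.
rewrite [X in closed X](_ : _ = gm @` (`[0, 1] `&` phi @^-1` D)) //.
apply/seteqP; split => [x /= Dx|x /= [t [/= t01 Dt] <-]].
  have [[t /=]|nx] := pselect ((gm @` `]0, 1[) x).
    rewrite in_itv /= => t01 tx; exists t => //; split => /=.
      by rewrite in_itv /=; lra.
    by move: Dx; rewrite -tx edge_funE //; lra.
  by move: Dx; rewrite /edge_fun memNset.
by rewrite edge_funE //; move: t01; rewrite in_itv.
Qed.

(** Height beyond the parameter [c]: zero up to [c], then rising with slope one to the midpoint of
    [[c, 1]]. The descent brings it back to zero at [1], so that its extension by zero to the graph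
    is continuous. *)
Definition tent c t : R := Num.max 0 (Num.min (t - c) (1 - t)).

Lemma tent_continuous c : continuous (tent c).
Proof.
move=> t; apply: (@continuous_max _ _ (fun=> 0) (fun t => Num.min (t - c) (1 - t))).
  exact: cvg_cst.
by apply: continuous_min; apply: cvgB;
  [exact: cvg_id|exact: cvg_cst|exact: cvg_cst|exact: cvg_id].
Qed.

Lemma tent01 c : 0 <= c < 1 -> tent c 0 = 0 /\ tent c 1 = 0.
Proof.
by move=> c01; split; rewrite /tent; [case: (leP (0 - c)
  (1 - 0))|case: (leP (1 - c) (1 - 1))] => ?;
  rewrite ?subr0 ?subrr; case: leP => ? //; lra.
Qed.

(** Below the midpoint [(c + 1) / 2] the tent is on its rising side, so a positive height determines
    the parameter: it is the height plus [c]. *)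
Lemma edge_fun_tent_inj (dl : R -> G) (c : R) u u' : edge dl -> 0 <= c < 1 ->
  ~ (dl @` `[(c + 1) / 2, 1]) u -> ~ (dl @` `[(c + 1) / 2, 1]) u' ->
  0 < edge_fun dl (tent c) u -> edge_fun dl (tent c) u' = edge_fun dl (tent c) u ->
  u = u'.
Proof.
move=> edl c01.
have [t0 t1] := tent01 c01.
have key v : ~ (dl @` `[(c + 1) / 2, 1]) v -> 0 < edge_fun dl (tent c) v ->
    dl (edge_fun dl (tent c) v + c) = v.
  move=> nv; have [[t /=]|nt] := pselect ((dl @` `]0, 1[) v); last first.
    by rewrite /edge_fun memNset // ltxx.
  rewrite in_itv /= => t01 tv.
  have tc : t < (c + 1) / 2.
    by rewrite ltNge; apply/negP => h; apply: nv; exists t => //=;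
      rewrite in_itv /=; lra.
  rewrite -tv edge_funE //; last by lra.
  rewrite /tent; case: (leP (t - c) (1 - t)) => ?; last by exfalso; lra.
  case: (leP 0 (t - c)) => ?; last by rewrite ltxx.
  by rewrite subrK.
move=> nu nu' u0 uu; rewrite -(key u nu u0) -(key u' nu') uu //.
Qed.

End Edges.

(** * Edge sets of a graph, and paths that do not turn *)

Section GraphEdges.
Variables (R : realType) (G : topologicalType) (n : nat) (g : 'I_n -> R -> G).
Hypothesis hG : hausdorff_space G.

Definition graph_edges :=
  [/\ (forall i, continuous (g i)),
      (forall i s t, 0 <= s <= 1 -> 0 <= t <= 1 -> g i s = g i t -> s = t),
      (forall x, exists i, (g i @` `[0, 1]) x) &
      (forall i j s t, i != j -> 0 <= s <= 1 -> 0 <= t <= 1 -> g i s = g j t ->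
        (s = 0 \/ s = 1) /\ (t = 0 \/ t = 1))].

Hypothesis gg : graph_edges.

Lemma edges_closed (P : set 'I_n) (a b : R) :
  closed (\bigcup_(i in P) (g i @` `[a, b])).
Proof.
have [cg _ _ _] := gg.
apply: closed_bigcup => [|i _]; first exact: finite_finset.
by apply: path_closed => //; exact: cg.
Qed.

(** The complement of the open arc is a finite union of compact pieces: the other edges and the two
    ends, written as paths over one-point intervals. *)
Lemma graph_edge i : edge (g i).
Proof.
have [cg ig cov cross] := gg; split; [exact: cg|exact: ig|].
rewrite [X in open X](_ : _ = ~` ((\bigcup_(j in [set j | j != i]) (g j @` `[0, 1]))
    `|` (g i @` `[0, 0]) `|` (g i @` `[1, 1]))).
  apply: closed_openC; apply: closedU; first apply: closedU.
  - exact: edges_closed.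
  - exact: path_closed.
  - exact: path_closed.
apply/seteqP; split => [x [t /=]|x nx].
  rewrite in_itv /= => t01 <- [[[j /= ji [s /=]]|[s /=]]|[s /=]]; rewrite in_itv /=
    => s01.
  - by move=> /(cross _ _ _ _ ji s01) [|_ []]; lra.
  - by move=> /ig st; have {}st : s = t by [apply: st; lra]; lra.
  - by move=> /ig st; have {}st : s = t by [apply: st; lra]; lra.
have [i' [t /=]] := cov x; rewrite in_itv /= => t01 tx.
have [ii|ii] := eqVneq i' i; last first.
  by exfalso; apply: nx; left; left; exists i' => //; exists t => //=; rewrite in_itv.
exists t; last by rewrite -ii.
have t0 : t != 0.
  apply/eqP => t0; apply: nx; left; right; exists 0; first by rewrite /= in_itv /= lexx.
  by rewrite -tx -ii t0.
have t1 : t != 1.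
  apply/eqP => t1; apply: nx; right; exists 1; first by rewrite /= in_itv /= lexx.
  by rewrite -tx -ii t1.
by rewrite /= in_itv /=; lra.
Qed.

Lemma edge_inside i j t : 0 < t < 1 -> (g j @` `[0, 1]) (g i t) -> i = j.
Proof.
have [_ _ _ cross] := gg.
move=> t01 [s /=]; rewrite in_itv /= => s01 st; apply/eqP/negPn/negP => ij.
have t01' : 0 <= t <= 1 by lra.
by have [[]] := cross _ _ _ _ ij t01' s01 (esym st); lra.
Qed.

Definition vertex_of (v : G) (j : 'I_n) := v = g j 0 \/ v = g j 1.

Lemma vertex_of_mem v i j : vertex_of v i -> (g j @` `[0, 1]) v -> vertex_of v j.
Proof.
have [cg ig cov cross] := gg.
move=> vi vj; have [<-//|ij] := eqVneq i j; move: vj => [t /=].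
rewrite in_itv /= => t01 tv; rewrite /vertex_of -tv.
suff [->|->] : t = 0 \/ t = 1 by [left|right].
have h0 : 0 <= (0 : R) <= 1 by lra.
have h1 : 0 <= (1 : R) <= 1 by lra.
case: vi => vi; rewrite vi in tv.
  exact: (cross _ _ _ _ ij h0 t01 (esym tv)).2.
exact: (cross _ _ _ _ ij h1 t01 (esym tv)).2.
Qed.

Lemma mem_vertex v j : vertex_of v j -> (g j @` `[0, 1]) v.
Proof.
by move=> [->|->]; [exists 0|exists 1] => //=; rewrite in_itv /=; lra.
Qed.

(** An edge is an arc and not a loop, so it can be oriented to start at [v] and end elsewhere;
    arguments at a vertex then take place at parameter [0]. *)
Lemma vertex_orient v j : vertex_of v j -> exists gm : R -> G,
  [/\ edge gm, gm 0 = v, gm @` `[0, 1] = g j @` `[0, 1] & gm 1 != v /\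
    (forall u, vertex_of u j <-> u = gm 0 \/ u = gm 1)].
Proof.
have ig : g j 0 = g j 1 -> False.
  have [_ ig _ _] := gg => /ig => h; have {}h : 0 = 1 :> R by apply: h; lra.
  lra.
move=> [->|->].
  exists (g j); split => //; first exact: graph_edge.
  by split; [apply/eqP => /esym/ig|].
exists (fun t => g j (1 - t)); split.
- exact: edge_rev (graph_edge j).
- by rewrite subr0.
- apply/seteqP; split => x [t /=]; rewrite in_itv /= => t01 <-.
    by exists (1 - t) => //=; rewrite in_itv /=; lra.
  by exists (1 - t) => /=; [rewrite in_itv /=; lra|rewrite opprB addrC subrK].
- rewrite subrr subr0; split; first by apply/eqP => /ig.
  by move=> u; split=> -[]; [right|left|right|left].
Qed.

Lemma mem_edgeP j x : (g j @` `[0, 1]) x -> vertex_of x j \/ (g j @` `]0, 1[) x.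
Proof.
move=> [t /=]; rewrite in_itv /= => t01 <-.
have [->|t0] := eqVneq t 0; first by left; left.
have [->|t1] := eqVneq t 1; first by left; right.
by right; exists t => //=; rewrite in_itv /=; lra.
Qed.

Definition noend (S : {set 'I_n}) := forall j v, j \in S -> vertex_of v j ->
  exists j', [/\ j' \in S, j' != j & (g j' @` `[0, 1]) v].

Definition full_edges (H : set G) : {set 'I_n} :=
  [set j | `[< g j @` `[0, 1] `<=` H >]].

(** As [gm] ranges over all edges in both orientations, [0 < c] forbids staying on either side of an
    inner point, and [c = 0] forbids staying on one edge at a vertex. One condition thus serves both
    kinds of points. *)
Definition no_turn (psi : R -> G) (r s : R) := forall (gm : R -> G) (c t0 e : R),
  edge gm -> 0 <= c < 1 -> r < t0 < s -> psi t0 = gm c -> 0 < e ->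
  exists t, [/\ r < t < s, `|t - t0| < e & ~ (gm @` `[c, 1]) (psi t)].

Section NoTurn.
Variable H : set G.
Hypothesis cH : closed H.
Hypothesis H_path : forall y, H y -> exists (psi : R -> G) (t0 r s : R),
  [/\ continuous psi, r < t0 < s, psi t0 = y,
      (forall t, r < t < s -> H (psi t)) & no_turn psi r s].

(* The path through [g j c] leaves both sides of [g j c], hence covers a
   neighbourhood by the intermediate value theorem. *)
Lemma edge_full_nbhs j c : 0 < c < 1 -> H (g j c) -> \forall d \near c, H (g j d).
Proof.
move=> c01 Hc; have ej := graph_edge j.
have [psi [t0 [r [s [cpsi t0rs psit0 Hpsi nt]]]]] := H_path Hc.
have oj := edge_open hG ej (lexx 0) (lexx 1).
have /nbhs_ballP [e /= e0 he] : nbhs t0 (psi @^-1` (g j @` `]0, 1[)).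
  apply: cpsi; apply: open_nbhs_nbhs; split => //; rewrite psit0.
  by exists c => //=; rewrite in_itv.
have he' t : `|t - t0| < e -> exists2 d, 0 < d < 1 & g j d = psi t.
  move=> tt; have [|d /=] := he t; first by rewrite /ball /= distrC.
  by rewrite in_itv /=; exists d.
have [t1 [t1rs t1e n1]] : exists t, [/\ r < t < s, `|t - t0| < e & ~ (g j @` `[c,
  1]) (psi t)].
  by apply: nt => //; lra.
(* The reversed edge turns the same condition into one about the other side of [g j c]. *)
have [t2 [t2rs t2e n2]] : exists t, [/\ r < t < s, `|t - t0| < e &
    ~ ((fun t => g j (1 - t)) @` `[1 - c, 1]) (psi t)].
  by apply: nt => //; [exact: edge_rev|lra|rewrite opprB addrC subrK].
have [d1 d101 d1E] := he' t1 t1e; have [d2 d201 d2E] := he' t2 t2e.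
have d1c : d1 < c.
  rewrite ltNge; apply/negP => cd; apply: n1; exists d1 => //=; rewrite in_itv /=; lra.
have cd2 : c < d2.
  rewrite ltNge; apply/negP => cd; apply: n2; exists (1 - d2) => /=;
    last by rewrite opprB addrC subrK.
  by rewrite in_itv /=; lra.
pose a := Num.min t1 t2; pose b := Num.max t1 t2.
have ab : a <= b by rewrite /a /b; case: (leP t1 t2) => ?; lra.
have inab t : t \in `[a, b] -> r < t < s /\ `|t - t0| < e.
  move: t1e t2e; rewrite in_itv /= /a /b !ltr_distl.
  by case: (leP t1 t2) => ? ? ? ?; split; lra.
have cphi : {within `[a, b], continuous (edge_coord (g j) \o psi)}.
  apply: continuous_in_subspaceT => t /[!inE] /inab [_ /he' [d d01 dE]].
  by apply: continuous_comp; [exact: cpsi|rewrite -dE; exact: edge_coord_cvg].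
have phi1 : edge_coord (g j) (psi t1) = d1 by rewrite -d1E edge_coordK//; lra.
have phi2 : edge_coord (g j) (psi t2) = d2 by rewrite -d2E edge_coordK//; lra.
have sub d : d1 < d < d2 -> H (g j d).
  move=> d12.
  have [|t tab /= td] := @IVT R (edge_coord (g j) \o psi) a b d ab cphi.
    by rewrite /= /a /b; case: (leP t1 t2) => _; rewrite phi1 phi2;
      [case: (leP d1 d2)|case: (leP d2 d1)] => ?; lra.
  have [trs te] := inab t tab; have [d' d'01 d'E] := he' t te.
  have E : edge_coord (g j) (g j d') = d' by apply: edge_coordK => //; lra.
  by have := Hpsi t trs; rewrite -d'E; move: td; rewrite -d'E E => ->.
near=> d; apply: sub; apply/andP; split; near: d; [exact: lt_nbhsr|exact: lt_nbhsl].
Unshelve. all: by end_near. Qed.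

(** The inner parameters sent into [H] form a nonempty subset of []0, 1[] that is both open and
    closed in it; the ends follow because [H] is closed. *)
Lemma edge_full j c : 0 < c < 1 -> H (g j c) -> j \in full_edges H.
Proof.
move=> c01 Hc; have cgj : continuous (g j) by have [] := gg.
pose A := `]0%R, 1%R[%classic `&` g j @^-1` H.
have AE : A = `]0%R, 1%R[%classic.
  have /connected_intervalP : is_interval (`]0, 1[%classic : set R) by move=>
    x y /=; rewrite !in_itv /= => ? ? z ?; rewrite in_itv /=; lra.
  apply.
  - by exists c; split => //=; rewrite in_itv.
  - exists A; last by rewrite /A setIA setIid.
    rewrite openE => d [/=]; rewrite in_itv /= => d01 Hd; rewrite /interior /A.
    apply: filterI; last exact: edge_full_nbhs.
    by apply: open_nbhs_nbhs; split; [exact: interval_open|rewrite /= in_itv].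
  - exists (g j @^-1` H) => //; apply: preimage_closed => // x _; exact: cgj.
rewrite inE; apply/asboolP => y [t /=]; rewrite in_itv /= => t01 <- {y}.
have cgH : closed (g j @^-1` H) by apply: preimage_closed => // x _; exact: cgj.
apply: (cgH t) => V Vt.
suff : (`]0%R, 1%R[%classic `&` V) !=set0.
  by move=> [x [x01 Vx]]; exists x; split => //; move: x01; rewrite -AE => -[].
have /nbhs_ballP [e /= e0 eV] := Vt.
(* With [d < e] and [d <= 1 / 2], moving [d / 2] towards the middle gives an inner parameter close
   to [t], also when [t] is [0] or [1]. *)
pose d := Num.min e 1 / 2.
have d0 : 0 < d by rewrite divr_gt0 // lt_min e0 ltr01.
have [de d1] : d < e /\ d <= 1 / 2 by rewrite /d; case: (leP e 1) => ?; split; lra.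
have [t2|t2] := leP t (1 / 2).
  exists (t + d / 2); split => /=; first by rewrite in_itv /=; lra.
  by apply: eV; rewrite /ball /=; rewrite ltr_distl; lra.
exists (t - d / 2); split => /=; first by rewrite in_itv /=; lra.
by apply: eV; rewrite /ball /=; rewrite ltr_distl; lra.
Qed.

(** Near [v] the path must leave any given edge at [v], and it can only do so into the interior of
    another edge at [v], which is then full. Applied to [j] and again to the edge found, this gives
    two distinct full edges, whether or not [j] is full. *)
Lemma vertex_two_edges v j : H v -> vertex_of v j -> exists j1 j2,
  [/\ j1 \in full_edges H, j2 \in full_edges H, j1 != j2, (g j1 @` `[0, 1]) v &
    (g j2 @` `[0, 1]) v].
Proof.
move=> Hv vj.
have [psi [t0 [r [s [cpsi t0rs psit0 Hpsi nt]]]]] := H_path Hv.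
(* Edges not through [v], and all vertices other than [v]. A point off [C] is [v] itself or an inner
   point of an edge at [v]. *)
pose C := (\bigcup_(i in [set i | ~ (g i @` `[0, 1]) v]) (g i @` `[0, 1])) `|`
  ((\bigcup_(i in [set i | g i 0 <> v]) (g i @` `[0, 0])) `|`
   (\bigcup_(i in [set i | g i 1 <> v]) (g i @` `[1, 1]))).
have cC : closed C.
  by apply: closedU; last apply: closedU; exact: edges_closed.
have nCv : ~ C v.
  move=> [[i iv]|[[i /= iv]|[i /= iv]]] //.
    by move=> [t /=]; rewrite in_itv /= -eq_le => /eqP <-.
  by move=> [t /=]; rewrite in_itv /= -eq_le => /eqP <-.
have /nbhs_ballP [e /= e0 he] : nbhs t0 (psi @^-1` (~` C)).
  apply: cpsi; apply: open_nbhs_nbhs; split; first exact: closed_openC.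
  by rewrite psit0.
have step i : vertex_of v i -> exists i', [/\ i' \in full_edges H, i' != i &
  vertex_of v i'].
  move=> vi; have [gm [egm gm0 gmE _]] := vertex_orient vi.
  have [t [trs te nt']] : exists t, [/\ r < t < s, `|t - t0| < e & ~ (gm @` `[0,
    1]) (psi t)].
    by apply: nt => //; [lra|rewrite psit0 gm0].
  rewrite gmE in nt'.
  have nC : ~ C (psi t) by apply: he; rewrite /ball /= distrC.
  have [i' i't] : exists i, (g i @` `[0, 1]) (psi t) by have [] := gg.
  have vi' : (g i' @` `[0, 1]) v by apply: contrapT => h; apply: nC; left; exists i'.
  have [[E|E]|[d /=]] := mem_edgeP i't.
  - have [E'|E'] := pselect (g i' 0 = v).
      by exfalso; apply: nt'; rewrite E E'; exact: mem_vertex.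
    exfalso; apply: nC; right; left; exists i' => //; exists 0 => //=.
    by rewrite in_itv /= lexx.
  - have [E'|E'] := pselect (g i' 1 = v).
      by exfalso; apply: nt'; rewrite E E'; exact: mem_vertex.
    exfalso; apply: nC; right; right; exists i' => //; exists 1 => //=.
    by rewrite in_itv /= lexx.
  - rewrite in_itv /= => d01 dE; exists i'; split.
    + by apply: (edge_full d01); rewrite dE; exact: Hpsi.
    + by apply/eqP => ii; apply: nt'; rewrite -ii.
    + exact: vertex_of_mem vi vi'.
have [j1 [j1H _ vj1]] := step j vj; have [j2 [j2H j21 vj2]] := step j1 vj1.
by exists j2, j1; split => //; exact: mem_vertex.
Qed.

Lemma no_turn_union : noend (full_edges H) /\
  forall y, H y -> exists2 j, j \in full_edges H & (g j @` `[0, 1]) y.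
Proof.
split=> [j v jS vj|y Hy].
  have Hv : H v by move: jS; rewrite inE => /asboolP; apply; exact: mem_vertex.
  have [j1 [j2 [j1S j2S j12 v1 v2]]] := vertex_two_edges Hv vj.
  have [E|E] := eqVneq j1 j; last by exists j1.
  by exists j2; split => //; rewrite -E eq_sym.
have [j yj] : exists i, (g i @` `[0, 1]) y by have [] := gg.
have [vj|[d /=]] := mem_edgeP yj.
  by have [j1 [_ [j1S _ _ v1 _]]] := vertex_two_edges Hy vj; exists j1.
by rewrite in_itv /= => d01 dE; exists j => //; apply: (edge_full d01); rewrite dE.
Qed.

End NoTurn.
End GraphEdges.

(** * Graph bundles *)

Section Chart.
Variables (R : realType) (E B G : topologicalType) (p : E -> B).

(* [pi] is the fibre coordinate and [k] the inverse of the trivialization; outside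
   [U] they carry no information. *)
Definition chart (U : set B) (pi : E -> G) (k : B * G -> E) :=
  [/\ open U, (forall x, U (p x) -> {for x, continuous pi}),
      (forall b y, U b -> {for (b, y), continuous k}),
      (forall x, U (p x) -> k (p x, pi x) = x) &
      (forall b y, U b -> p (k (b, y)) = b /\ pi (k (b, y)) = y)].

End Chart.

Lemma bundle_chart (R : realType) (E B G : pseudoMetricType R) (p : E -> B) :
  graph_bundle G p -> forall b, exists (U : set B) (pi : E -> G) (k : B * G -> E),
  U b /\ chart p U pi k.
Proof.
move=> [_ _ cp _ loc] b; have [U [oU Ub [h [[k [ch ck hk kh]] hp]]]] := loc b.
exists U, (fun x => (h x).2), k; split=> //.
have opU : open (p @^-1` U) by apply: open_comp => // x _; exact: cp.
have oUG : open (U `*` [set: G]).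
  rewrite openE => -[x y] [/= Ux _]; exists (U, setT) => //=.
  by split; [exact: open_nbhs_nbhs|exact: filterT].
split => //.
- move=> x Ux; move: ch; rewrite continuous_open_subspace // => /(_ x).
  rewrite inE => /(_ Ux) chx; apply: (@continuous_comp _ _ _ h snd) => //.
  exact: cvg_snd.
- move=> c y Uc; move: ck; rewrite continuous_open_subspace // => /(_ (c, y)).
  by rewrite inE; apply.
- by move=> x Ux; have [_ E0] := hk x Ux; rewrite -(hp x Ux) -surjective_pairing.
- move=> c y Uc; have [Uk hkk] := kh (c, y) (conj Uc I).
  by rewrite -(hp _ Uk) hkk.
Qed.

(** * A solid box in [M]: folding and collapsing *)

Section Turn.
Variables (R : realType) (E B : uniformType) (G : topologicalType).
Variables (p : E -> B) (F : E -> E) (f : B -> B) (M : set E).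
Hypotheses (cE : compact [set: E]) (hE : hausdorff_space E).
Hypotheses (hG : hausdorff_space G).
Hypotheses (cp : continuous p) (cF : continuous F) (cf : continuous f).
Hypotheses (pF : forall x, p (F x) = f (p x)).
Hypotheses (mM : minimal_set F M).

(** Irreducibility in the form used for surgery: deleting [O] from [M] leaves the [k]-th image
    unchanged, so nothing of [M] was deleted. *)
Lemma irreducible_open k (O : set E) : open O ->
  (forall z, M z -> O z -> exists z', [/\ M z', ~ O z' & iter k F z' = iter k F z]) ->
  forall z, M z -> ~ O z.
Proof.
move=> oO HO; have cM : closed M by have [] := mM.
suff E0 : M `&` ~` O = M by move=> z; rewrite -{1}E0 => -[].
apply: (minimal_irreducible_iter cE hE cF mM (k := k)).
- by apply: closedI => //; exact: open_closedC.
- by move=> ? [].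
- move=> y /(minimal_iter_onto cE hE cF mM k) [z Mz zy].
  have [Oz|nOz] := pselect (O z); last by exists z.
  by have [z' [Mz' nOz' zz']] := HO z Mz Oz; exists z' => //; rewrite zz'.
Qed.

Variables (U : set B) (pi : E -> G) (kap : B * G -> E).
Hypothesis ch : chart p U pi kap.
Variables (gm : R -> G) (V : set B) (r0 s0 : R).
Hypotheses (egm : edge gm) (r00 : 0 <= r0) (s01 : s0 <= 1).
Hypotheses (oV : open V) (VU : V `<=` U).
Hypothesis box : forall b t, V b -> r0 < t < s0 -> M (kap (b, gm t)).

Lemma box_open (W : set B) a b : open W -> W `<=` U -> 0 <= a -> b <= 1 ->
  open [set x | W (p x) /\ (gm @` `]a, b[) (pi x)].
Proof.
move=> oW WU a0 b1; have [oU cpi _ _ _] := ch.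
rewrite openE => x [Wx gx]; apply: filterI.
  by apply: (cp (x := x)); exact: open_nbhs_nbhs.
apply: (cpi x (WU _ Wx)); apply: open_nbhs_nbhs; split => //; exact: edge_open.
Qed.

Lemma box_path_continuous k b t : U b ->
  {for (t, b), continuous (fun q : R * B => iter k F (kap (q.2, gm q.1)))}.
Proof.
move=> Ub; have [oU cpi ckap _ _] := ch.
apply: (@continuous_comp _ _ _ (fun q : R * B => kap (q.2, gm q.1)) (iter k F));
  last exact: iter_continuous.
apply: (@continuous_comp _ _ _ (fun q : R * B => (q.2, gm q.1)) kap); last exact: ckap.
apply: pair_continuous; first exact: cvg_snd.
apply: (@continuous_comp _ _ _ fst gm); first exact: cvg_fst.
by have [cg _ _] := egm; exact: cg.
Qed.

Lemma box_mem z a b : V (p z) -> 0 <= a -> b <= 1 -> (gm @` `]a, b[) (pi z) ->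
  exists2 t, a < t < b & z = kap (p z, gm t).
Proof.
have [_ _ _ kpi _] := ch => Vz a0 b1 [t /=]; rewrite in_itv /= => tab tz.
by exists t => //; rewrite tz kpi //; exact: VU.
Qed.

Lemma box_path_continuous1 k b t : U b ->
  {for t, continuous (fun t => iter k F (kap (b, gm t)))}.
Proof.
move=> Ub.
apply: (@continuous_comp _ _ _ (fun t : R => (t, b)) (fun q : R * B =>
  iter k F (kap (q.2, gm q.1)))).
  by apply: pair_continuous; [exact: cvg_id|exact: cst_continuous].
exact: box_path_continuous.
Qed.

Lemma box_path_continuous2 k b t : U b ->
  {for b, continuous (fun b => iter k F (kap (b, gm t)))}.
Proof.
move=> Ub.
apply: (@continuous_comp _ _ _ (fun b : B => (t, b)) (fun q : R * B =>
  iter k F (kap (q.2, gm q.1)))).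
  by apply: pair_continuous; [exact: cst_continuous|exact: cvg_id].
exact: box_path_continuous.
Qed.

Variables (U2 : set B) (pi2 : E -> G) (kap2 : B * G -> E).
Hypothesis ch2 : chart p U2 pi2 kap2.

(* Otherwise an open piece of [M] over [(a, t0)] could be removed without changing
   the image [iter k F @` M], the removed points being covered again from [(t0, d)]. *)
Lemma box_no_fold k b (dl : R -> G) c a t0 d :
  V b -> U2 (iter k f b) -> edge dl -> 0 <= c < 1 -> r0 < a -> a < t0 -> t0 < d ->
    d < s0 ->
  let psi t := pi2 (iter k F (kap (b, gm t))) in
  (forall t, a <= t <= d -> ~ (dl @` `[(c + 1) / 2, 1]) (psi t)) ->
  psi t0 = dl c ->
  0 < edge_fun dl (tent c) (psi a) -> 0 < edge_fun dl (tent c) (psi d) -> False.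
Proof.
move=> Vb U2b edl c01 r0a at0 t0d ds0 psi stay psit0 wa wd.
have [oU cpi ckap kpi pik] := ch; have [oU2 cpi2 ckap2 kpi2 pik2] := ch2.
have [tc0 tc1] := tent01 c01.
(* Height beyond [dl c]; along the path it vanishes at [t0] and is positive at [a] and [d]. *)
pose w x := edge_fun dl (tent c) (pi2 x).
have cw x : U2 (p x) -> {for x, continuous w}.
  move=> U2x; apply: (@continuous_comp _ _ _ pi2 (edge_fun dl (tent c)));
    first exact: cpi2.
  by apply: edge_fun_continuous => //; exact: tent_continuous.
pose X (q : R * B) := iter k F (kap (q.2, gm q.1)).
have pX t b' : U b' -> p (X (t, b')) = iter k f b'.
  by move=> Ub'; rewrite /X /= (iter_factor pF) (pik _ _ Ub').1.
have Ub := VU Vb.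
have cX t : {for (t, b), continuous X} by exact: box_path_continuous.
have cwX t : {for (t, b), continuous (w \o X)}.
  by apply: continuous_comp; [exact: cX|apply: cw; rewrite pX].
have wt0 : w (X (t0, b)) = 0.
  rewrite /w /X /= -/(psi t0) psit0 edge_funE //; last by lra.
  rewrite /tent subrr; case: (leP 0 (1 - c)) => ?; rewrite ?maxxx //; lra.
have [e [e0 ea ed]] : exists e : R, [/\ 0 < e, e < w (X (a, b)) & e < w (X (d, b))].
  exists (Num.min (w (X (a, b))) (w (X (d, b))) / 2).
  by move: wa wd; rewrite -[edge_fun _ _ (psi a)]/(w (X (a, b)))
    -[edge_fun _ _ (psi d)]/(w (X (d, b)));
    case: (leP (w (X (a, b))) (w (X (d, b)))) => ? ? ?; split; lra.
have nwX t : nbhs (w (X (t, b))) `<=` fun A => nbhs b (fun b' => A (w (X (t, b')))).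
  move=> A nA.
  have : {for b, continuous (fun b' => w (X (t, b')))}.
    apply: (@continuous_comp _ _ _ (fun b' : B => (t, b')) (w \o X)); last exact: cwX.
    by apply: pair_continuous; [exact: cst_continuous|exact: cvg_id].
  by apply.
(* The fold persists over base points near [b], the level [e] being below both ends and the bottom
   below [e / 2]. The condition on all of [[a, d]] persists by compactness of that interval. *)
have : nbhs b [set b' | [/\ V b', U2 (iter k f b'),
    (forall t, a <= t <= d -> ~ (dl @` `[(c + 1) / 2, 1]) (pi2 (X (t, b')))),
    e < w (X (a, b')) /\ e < w (X (d, b')) & w (X (t0, b')) < e / 2]].
  have n1 : nbhs b V by exact: open_nbhs_nbhs.
  have n2 : nbhs b [set b' | U2 (iter k f b')].
    have cfk : {for b, continuous (iter k f)} by exact: iter_continuous.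
    by apply: (cfk U2); exact: open_nbhs_nbhs.
  have n3 : nbhs b [set b' | forall t, a <= t <= d ->
      ~ (dl @` `[(c + 1) / 2, 1]) (pi2 (X (t, b')))].
    have /compact_near_coveringP ncov := @segment_compact R a d.
    pose P b' t := ~ (dl @` `[(c + 1) / 2, 1]) (pi2 (X (t, b'))).
    have {ncov}/= := ncov B (nbhs b) P _.
    have HP : forall t, `[a, d]%classic t ->
       \forall t' \near t & b' \near b, P b' t'.
      move=> t /=; rewrite in_itv /= => tad.
      have cpX : {for (t, b), continuous (pi2 \o X)}.
        by apply: continuous_comp; [exact: cX|apply: cpi2; rewrite pX].
      suff : nbhs (t, b) [set q | P q.2 q.1] by [].
      have oC : open (~` (dl @` `[(c + 1) / 2, 1])).
        by apply: closed_openC; apply: path_closed => //; case: edl.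
      have /cpX : nbhs ((pi2 \o X) (t, b)) (~` (dl @` `[(c + 1) / 2, 1])).
        by apply: open_nbhs_nbhs; split => //; exact: stay.
      exact.
    move=> /(_ _ HP); apply: filterS => b' /= h t tad.
    by apply: h; rewrite /= in_itv.
  have n4 : nbhs b [set b' | e < w (X (a, b')) /\ e < w (X (d, b'))].
    have ha := nwX a [set v | e < v] (lt_nbhsr ea).
    have hd := nwX d [set v | e < v] (lt_nbhsr ed).
    exact: filterI ha hd.
  have n5 : nbhs b [set b' | w (X (t0, b')) < e / 2].
    have e20 : w (X (t0, b)) < e / 2 by rewrite wt0; lra.
    exact: nwX t0 [set v | v < e / 2] (lt_nbhsl e20).
  by near=> b'; split; near: b'.
rewrite nbhsE => -[N [oN Nb] NH].
have NV b' : N b' -> V b' by move=> /NH [].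
(* The piece to delete: box points over []a, t0[] whose image has height between [e / 2] and [e].
   The path over [[t0, d]] takes all these heights again, and equal heights mean equal images
   here. *)
pose O := [set x | N (p x) /\ (gm @` `]a, t0[) (pi x)] `&` [set x |
  e / 2 < w (iter k F x) < e].
have [r00' s01'] := (r00, s01).
have a01 : 0 <= a by lra.
have t01 : t0 <= 1 by lra.
have oO : open O.
  have oN' : open [set x | N (p x) /\ (gm @` `]a, t0[) (pi x)].
    by apply: box_open => // b' /NV /VU.
  rewrite openE => x [Nx wx]; apply: filterI; first exact: open_nbhs_nbhs.
  have cwF : {for x, continuous (w \o iter k F)}.
    apply: continuous_comp; first exact: iter_continuous.
    by apply: cw; rewrite (iter_factor pF); have [] := NH _ Nx.1.
  apply: (cwF `]e / 2, e[%classic); apply: open_nbhs_nbhs; split;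
    first exact: interval_open.
  by rewrite /= in_itv.
have wpath b' (u v : R) : N b' -> u <= v -> {within `[u, v], continuous (fun t =>
  w (X (t, b')))}.
  move=> Nb' uv; have [Vb' U2b' _ _ _] := NH _ Nb'.
  apply: continuous_subspaceT => t.
  apply: (@continuous_comp _ _ _ (fun t => X (t, b')) w); last by apply: cw;
    rewrite pX //; exact: VU.
  by apply: box_path_continuous1; exact: VU.
have covered z : M z -> O z -> exists z', [/\ M z', ~ O z' & iter k F z' = iter k F z].
  move=> Mz [[Nz gz] wz]; have [Vz U2z stayz [_ wdz] wt0z] := NH _ Nz.
  have {}wz : e / 2 < w (iter k F z) < e by [].
  have [t tat0 zE] := box_mem Vz a01 t01 gz.
  have wv : Num.min (w (X (t0, p z))) (w (X (d, p z))) <= w (iter k F z) <=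
            Num.max (w (X (t0, p z))) (w (X (d, p z))).
    by case: (leP (w (X (t0, p z))) (w (X (d, p z)))) => ?; lra.
  have [t' t'd /= wt'] := IVT (ltW t0d) (wpath _ t0 d Nz (ltW t0d)) wv.
  move: t'd; rewrite in_itv /= => t'd.
  have Mz' : M (kap (p z, gm t')) by apply: box => //; lra.
  exists (kap (p z, gm t')); split => //.
    move=> [[_ [s /=]]]; rewrite in_itv /= (pik _ _ (VU Vz)).2 => sat0 ss.
    by have [_ ig _] := egm; have {}ss : s = t' by [apply: ig => //; lra]; lra.
  have U2z1 : U2 (p (iter k F z)) by rewrite (iter_factor pF).
  have U2z2 : U2 (p (X (t', p z))) by rewrite pX //; exact: VU.
  rewrite -(kpi2 _ U2z1) -[LHS](kpi2 _ U2z2); congr (kap2 (_, _)).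
    by rewrite pX ?(iter_factor pF) //; exact: VU.
  apply: (edge_fun_tent_inj edl c01).
  - by apply: stayz; lra.
  - by rewrite zE; apply: stayz; lra.
  - by rewrite -/(w (X (t', p z))) wt'; lra.
  - exact: esym wt'.
have noO := irreducible_open oO covered.
(* The level [3 / 4 * e], strictly between [e / 2] and [e], is attained strictly between [a] and
   [t0], so the deleted piece does meet [M]. *)
have wv : Num.min (w (X (a, b))) (w (X (t0, b))) <= 3 / 4 * e <=
            Num.max (w (X (a, b))) (w (X (t0, b))).
  by rewrite wt0; case: (leP (w (X (a, b))) 0) => ?; lra.
have [t tat0 /= wt] := IVT (ltW at0) (wpath _ a t0 Nb (ltW at0)) wv.
move: tat0; rewrite in_itv /= => tat0.
have ta : t != a by apply/eqP => ta; move: wt; rewrite ta; lra.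
have tt0 : t != t0 by apply/eqP => tt0; move: wt; rewrite tt0; lra.
apply: (noO (kap (b, gm t))); first by apply: box => //; lra.
have [pE piE] := pik b (gm t) Ub.
split; last by rewrite /= -[iter k F _]/(X (t, b)) wt; lra.
by split; rewrite ?pE // piE; exists t => //=; rewrite in_itv /=; lra.
Unshelve. all: by end_near. Qed.

(** A path that stays on one side near [t0] and is constant on no subinterval gets strictly beyond
    [dl c] both before and after [t0]: this is a fold. *)
Lemma box_no_turn k b : V b -> U2 (iter k f b) ->
  (forall r s, r0 < r -> r < s -> s < s0 -> exists t t', [/\ r <= t <= s, r <= t' <= s &
    iter k F (kap (b, gm t)) <> iter k F (kap (b, gm t'))]) ->
  no_turn (fun t => pi2 (iter k F (kap (b, gm t)))) r0 s0.
Proof.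
move=> Vb U2b ncst dl c t0 e edl c01 t0rs psit0 e0.
apply: contrapT => stay.
have [oU cpi ckap kpi pik] := ch; have [oU2 cpi2 ckap2 kpi2 pik2] := ch2.
have Ub := VU Vb.
pose psi t := pi2 (iter k F (kap (b, gm t))).
have pX t : p (iter k F (kap (b, gm t))) = iter k f b.
  by rewrite (iter_factor pF) (pik _ _ Ub).1.
have cpsi : continuous psi.
  move=> t; apply: (@continuous_comp _ _ _ (fun t => iter k F (kap (b, gm t))) pi2).
    exact: box_path_continuous1.
  by apply: cpi2; rewrite pX.
have tpos u : ~ (dl @` `[(c + 1) / 2, 1]) u -> u <> dl c -> (dl @` `[c, 1]) u ->
    0 < edge_fun dl (tent c) u.
  have [tc0 tc1] := tent01 c01.
  move=> nu ncu [s /=]; rewrite in_itv /= => sc su.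
  rewrite -su edge_funE //; last by lra.
  have sc' : s != c by apply/eqP => sc'; apply: ncu; rewrite -su sc'.
  have s1 : s < 1.
    rewrite ltNge; apply/negP => s1; apply: nu; exists s => //=.
    by rewrite in_itv /=; lra.
  by rewrite /tent lt_max lt_min; apply/orP; right; lra.
have [e1 e10 e1stay] : exists2 e1 : R, 0 < e1 & forall t, `|t - t0| < e1 ->
    [/\ r0 < t < s0, (dl @` `[c, 1]) (psi t) & ~ (dl @` `[(c + 1) / 2, 1]) (psi t)].
  have n1 : nbhs t0 (psi @^-1` (~` (dl @` `[(c + 1) / 2, 1]))).
    apply: cpsi; apply: open_nbhs_nbhs; split.
      by apply: closed_openC; apply: path_closed => //; case: edl.
    rewrite {1}/psi psit0 => -[s /=]; rewrite in_itv /= => sc.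
    have [_ idl _] := edl => /idl sc'; have {}sc' : s = c by apply: sc'; lra.
    by lra.
  have n2 : nbhs t0 [set t | r0 < t < s0].
    have : nbhs t0 (`]r0, s0[%classic : set R).
      by apply: open_nbhs_nbhs; split; [exact: interval_open|rewrite /= in_itv].
    by apply: filterS => t /=; rewrite in_itv.
  have /nbhs_ballP [e1 /= e10 he1] : nbhs t0 (psi @^-1` (~` (dl @` `[(c + 1) / 2,
    1])) `&` [set t | r0 < t < s0]).
    exact: filterI n1 n2.
  exists (Num.min e1 e); first by rewrite lt_min e10 e0.
  move=> t; rewrite lt_min => /andP [te1 te].
  have [nt trs] : (psi @^-1` (~` (dl @` `[(c + 1) / 2, 1])) `&` [set t |
    r0 < t < s0]) t.
    by apply: he1; rewrite /ball /= distrC.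
  split => //; apply: contrapT => nct; apply: stay; by exists t.
have fibre t : psi t = psi t0 -> iter k F (kap (b, gm t)) = iter k F (kap (b, gm t0)).
  move=> tt0; rewrite -[LHS]kpi2 ?pX // -[RHS]kpi2 ?pX //.
  by rewrite -[pi2 _]/(psi t) tt0.
(* The path cannot rest at [dl c] on a subinterval: over one base point, equal fibre coordinates
   mean equal points of [E]. *)
have move_away r s : r < s -> (forall t, r <= t <= s -> `|t - t0| < e1) ->
    exists t, r <= t <= s /\ 0 < edge_fun dl (tent c) (psi t).
  move=> rs near0.
  have [r0r _ _] : [/\ r0 < r < s0, (dl @` `[c, 1]) (psi r) & ~ (dl @` `[(c + 1)
    / 2, 1]) (psi r)].
    by apply: e1stay; apply: near0; rewrite lexx ltW.
  have [ss0 _ _] : [/\ r0 < s < s0, (dl @` `[c, 1]) (psi s) & ~ (dl @` `[(c + 1)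
    / 2, 1]) (psi s)].
    by apply: e1stay; apply: near0; rewrite lexx ltW.
  have [t [t' [trs t'rs tt']]] := ncst r s (andP r0r).1 rs (andP ss0).2.
  have [E1|E1] := pselect (psi t = dl c); last first.
    by exists t; split => //; have [_ i1 i2] := e1stay t (near0 t trs); exact: tpos.
  have [E2|E2] := pselect (psi t' = dl c); last first.
    by exists t'; split => //; have [_ i1 i2] := e1stay t' (near0 t' t'rs); exact: tpos.
  by case: tt'; rewrite (fibre t) ?(fibre t') // /psi psit0.
have [a [a0 wa]] := move_away (t0 - e1 / 2) (t0 - e1 / 4)
  ltac:(lra) ltac:(move=> t; rewrite ltr_distl => ?; lra).
have [d [d0 wd]] := move_away (t0 + e1 / 4) (t0 + e1 / 2)
  ltac:(lra) ltac:(move=> t; rewrite ltr_distl => ?; lra).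
have [r0a _ _] : [/\ r0 < a < s0, (dl @` `[c, 1]) (psi a) & ~ (dl @` `[(c + 1) / 2,
  1]) (psi a)].
  by apply: e1stay; rewrite ltr_distl; lra.
have [ds0 _ _] : [/\ r0 < d < s0, (dl @` `[c, 1]) (psi d) & ~ (dl @` `[(c + 1) / 2,
  1]) (psi d)].
  by apply: e1stay; rewrite ltr_distl; lra.
apply: (@box_no_fold k b dl c a t0 d) => //.
- by have /andP [] := r0a.
- by lra.
- by lra.
- by have /andP [] := ds0.
- move=> t tad; have [] // := e1stay t.
  by rewrite ltr_distl; lra.
Qed.

(** Taken over the closure of [V], so that the set is closed, as Baire requires. *)
Definition collapse k r s : set B := [set b | closure V b /\
  forall t t', r <= t <= s -> r <= t' <= s ->
    iter k F (kap (b, gm t)) = iter k F (kap (b, gm t'))].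

Hypothesis cVU : closure V `<=` U.

Lemma collapse_closed k r s : closed (collapse k r s).
Proof.
move=> b clb.
have Vb : closure V b.
  by apply: (@closed_closure _ V); apply: closureS clb => b' [].
split => // t t' trs t'rs; apply: contrapT => ne.
move: hE; rewrite open_hausdorff => /(_ _ _ (introN eqP ne)) [[A1 A2] /= []].
rewrite !inE => A1t A2t' [oA1 oA2 A12].
have n1 : nbhs b ((fun b => iter k F (kap (b, gm t))) @^-1` A1).
  by apply: box_path_continuous2; [exact: cVU|exact: open_nbhs_nbhs].
have n2 : nbhs b ((fun b => iter k F (kap (b, gm t'))) @^-1` A2).
  by apply: box_path_continuous2; [exact: cVU|exact: open_nbhs_nbhs].
have [b' [[_ cb'] [/= A1b' A2b']]] := clb _ (filterI n1 n2).
suff : (A1 `&` A2) (iter k F (kap (b', gm t))) by rewrite A12.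
by split => //; rewrite (cb' t t').
Qed.

(** Over an open set of such base points the open arc from [r] to [s] could be deleted: each of its
    points has the same image as the end at [gm r], which is kept. *)
Lemma collapse_interior k r s : r0 < r -> r < s -> s < s0 -> (collapse k r s)° = set0.
Proof.
move=> r0r rs ss0; rewrite -subset0 => b; rewrite /interior nbhsE => -[W [oW Wb] Wc].
have [oU cpi ckap kpi pik] := ch.
have [b1 [Vb1 Wb1]] : V `&` W !=set0 by apply: (Wc _ Wb).1; exact: open_nbhs_nbhs.
have [r00' s01'] := (r00, s01).
have r0' : 0 <= r by lra. have s1' : s <= 1 by lra.
have oVW : open (V `&` W) by exact: openI.
have VWU : V `&` W `<=` U by move=> ? [/VU].
have oO := box_open oVW VWU r0' s1'.
apply: (irreducible_open (k := k) oO _ (z := kap (b1, gm ((r + s) / 2)))).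
- move=> z Mz [[Vz Wz] gz]; have [t trs zE] := box_mem Vz r0' s1' gz.
  exists (kap (p z, gm r)); split.
  + by apply: box => //; lra.
  + move=> [_ [u /=]]; rewrite in_itv /= (pik _ _ (VU Vz)).2 => urs.
    have [_ ig _] := egm => /ig h; have {}h : u = r by apply: h; lra.
    by lra.
  + by rewrite [in RHS]zE; apply: (Wc _ Wz).2; lra.
- by apply: box => //; lra.
- have [pE piE] := pik b1 (gm ((r + s) / 2)) (VU Vb1).
  split; rewrite ?pE //= piE; exists ((r + s) / 2) => //=.
  by rewrite in_itv /=; lra.
Qed.

End Turn.

(** * Fibres of a minimal set with interior *)

Section Fibres.
Variables (R : realType) (E B : uniformType) (G : topologicalType).
Variables (n : nat) (g : 'I_n -> R -> G).
Variables (p : E -> B) (F : E -> E) (f : B -> B) (M : set E).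
Hypotheses (cE : compact [set: E]) (hE : hausdorff_space E).
Hypotheses (cB : compact [set: B]) (hB : hausdorff_space B).
Hypotheses (hG : hausdorff_space G) (gg : graph_edges g).
Hypotheses (cp : continuous p) (cF : continuous F) (cf : continuous f).
Hypotheses (pF : forall x, p (F x) = f (p x)).
Hypotheses (mf : minimal_set f [set: B]) (mM : minimal_set F M).
Hypothesis pM : p @` M = [set: B].
Hypothesis charts : forall b, exists (U : set B) (pi : E -> G) (k : B * G -> E),
  U b /\ chart p U pi k.

Lemma solid_box : M° !=set0 -> exists U pi kap i V (r0 s0 : R),
  [/\ chart p U pi kap, open V /\ V !=set0, closure V `<=` U,
      [/\ 0 <= r0, r0 < s0 & s0 <= 1] &
      forall b t, V b -> r0 < t < s0 -> M (kap (b, g i t))].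
Proof.
move=> [x iMx]; have [U [pi [kap [Ux ch]]]] := charts (p x).
have [oU cpi ckap kpi pik] := ch; have [cg _ cov _] := gg.
have [i [t /=]] := cov (pi x); rewrite in_itv /= => t01 tx.
have cX : {for (p x, t), continuous (fun q : B * R => kap (q.1, g i q.2))}.
  apply: (@continuous_comp _ _ _ (fun q : B * R => (q.1, g i q.2)) kap);
    last exact: ckap.
  apply: pair_continuous; first exact: cvg_fst.
  by apply: (@continuous_comp _ _ _ snd (g i)); [exact: cvg_snd|exact: cg].
have : nbhs (p x, t) ((fun q : B * R => kap (q.1, g i q.2)) @^-1` M).
  by apply: cX; rewrite /= tx kpi.
move=> [[V1 I1] [/= nV1 nI1] VI].
have : nbhs (p x) (V1 `&` U) by apply: filterI => //; exact: open_nbhs_nbhs.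
rewrite nbhsE => -[V2 [oV2 V2x] V2s].
have [V [oV Vx cV]] := regular_shrink oV2 V2x.
have /nbhs_ballP [e /= e0 eI] := nI1.
(* Truncation keeps the parameters inside [[0, 1]]; the interval stays nondegenerate even if [t] is
   [0] or [1]. *)
exists U, pi, kap, i, V, (Num.max 0 (t - e)), (Num.min 1 (t + e)); split => //.
- by split => //; exists (p x).
- by move=> b Vb; have [] := V2s b (cV b Vb).
- split; first by rewrite le_max lexx.
    by rewrite lt_min !gt_max; lra.
  by rewrite ge_min lexx.
- move=> b s Vb; rewrite lt_min gt_max => s_in.
  apply: (VI (b, s)); split => /=.
    by have [] := V2s b (cV _ (subset_closure Vb)).
  by apply: eI; rewrite /ball /= ltr_distl; lra.
Qed.

Definition fibre_full (kap : B * G -> E) b : {set 'I_n} :=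
  full_edges g [set y | M (kap (b, y))].

Definition good_fibre (kap : B * G -> E) b := noend g (fibre_full kap b) /\
  forall y, M (kap (b, y)) -> exists2 j, j \in fibre_full kap b & (g j @` `[0, 1]) y.

(* Baire, applied to the sets of base points over which some iterate of [F]
   collapses a subarc with rational ends of the solid box. *)
Lemma generic_fibre : M° !=set0 -> forall W : set B, open W -> W !=set0 ->
  exists2 b, W b & forall U pi kap, chart p U pi kap -> U b -> good_fibre kap b.
Proof.
move=> /solid_box [U [pi [kap [i [V [r0 [s0 [ch [oV [b0 Vb0]] cVU [r00 rs0 s01] box]]]]]]]].
move=> W oW W0.
have VU : V `<=` U by apply: subset_trans cVU; exact: subset_closure.
have egi : edge (g i) by exact: graph_edge.
(* The exceptional sets are pushed forward by iterates of [f]: points over [b] come from box points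
   over preimages of [b], and it is there that no subarc may collapse. *)
pose N (q : nat * rat * rat) : set B :=
  if (r0 < ratr q.1.2) && (ratr q.1.2 < ratr q.2 :> R) && (ratr q.2 < s0)
  then iter q.1.1 f @` collapse F kap (g i) V q.1.1 (ratr q.1.2) (ratr q.2) else set0.
have ccol k r s : closed (collapse F kap (g i) V k r s).
  exact: (collapse_closed hE cF ch egi cVU).
have cN q : closed (N q).
  rewrite /N; case: ifP => _; last exact: closed0.
  by apply: image_closed => //; exact: iter_continuous.
have iN q : (N q)° = set0.
  rewrite /N; case: ifP => [/andP[/andP[h1 h2] h3]|_]; last exact: interior0.
  apply: minimal_image_interior => //.
  exact: (collapse_interior cE hE hG cp cF mM ch egi r00 s01 oV VU box).
have [b [Wb Nb]] := baire_countable cB cN iN oW W0.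
exists b => // U2 pi2 kap2 ch2 U2b.
have [oU cpi ckap kpi pik] := ch; have [oU2 cpi2 ckap2 kpi2 pik2] := ch2.
have cM : closed M by have [] := mM.
apply: no_turn_union => //.
  apply: preimage_closed => // y _.
  apply: (@continuous_comp _ _ _ (fun y => (b, y)) kap2); last exact: ckap2.
  by apply: pair_continuous; [exact: cst_continuous|exact: cvg_id].
move=> y Hy.
pose O := [set x | V (p x) /\ (g i @` `]r0, s0[) (pi x)].
have oO : open O by exact: (box_open hG cp ch egi oV VU).
have MO : M `&` O !=set0.
  have rs : r0 < (r0 + s0) / 2 < s0 by lra.
  exists (kap (b0, g i ((r0 + s0) / 2))); split; first exact: box.
  have [pE piE] := pik b0 (g i ((r0 + s0) / 2)) (VU _ Vb0).
  by split; rewrite ?pE // piE; exists ((r0 + s0) / 2) => //=; rewrite in_itv.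
(* An orbit started [m] steps before the given point enters the box at some time [k <= m]; the point
   is thus the image of a box point after the remaining [m - k] steps. *)
have [m Hm] := minimal_visit cE cF mM oO MO.
have [x0 Mx0 x0y] := minimal_iter_onto cE hE cF mM m Hy.
have [k km [Vz gz]] := Hm x0 Mx0.
set z := iter k F x0 in Vz gz.
have zy : iter (m - k) F z = kap2 (b, y) by rewrite /z -iterD subnK.
have [t trs zE] := box_mem ch VU Vz r00 s01 gz.
have fz : iter (m - k) f (p z) = b.
  by rewrite -(iter_factor pF) zy (pik2 _ _ U2b).1.
have pX t' : p (iter (m - k) F (kap (p z, g i t'))) = b.
  by rewrite (iter_factor pF) (pik _ _ (VU _ Vz)).1.
exists (fun t => pi2 (iter (m - k) F (kap (p z, g i t)))), t, r0, s0; split => //.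
- move=> t'; apply: (@continuous_comp _ _ _ (fun t => iter (m - k) F (kap (p z,
  g i t))) pi2).
    by apply: (box_path_continuous1 cF ch egi); exact: VU.
  by apply: cpi2; rewrite pX.
- by rewrite -zE zy (pik2 _ _ U2b).2.
- move=> t' t'rs; rewrite /= -{1}(pX t') kpi2 ?pX //.
  by apply: minimal_iter => //; exact: box.
- apply: (box_no_turn cE hE hG cp cF cf pF mM ch egi r00 s01 oV VU box ch2) => //.
    by rewrite fz.
  move=> r s r0r rs ss0.
  have [q1] := rat_in_itvoo rs; rewrite in_itv /= => /andP[rq1 q1s].
  have [q2] := rat_in_itvoo q1s; rewrite in_itv /= => /andP[q12 q2s].
  apply: contrapT => nt; apply: (Nb (m - k, q1, q2)%N); rewrite /N /=.
  rewrite (lt_trans r0r rq1) q12 (lt_trans q2s ss0) /=.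
  exists (p z) => //; split; first exact: subset_closure.
  move=> u u' uq u'q; apply: contrapT => ne; apply: nt; exists u, u'; split => //; lra.
Qed.

(* Good fibres are dense in [M], and only finitely many edge sets [S] can occur
   near a given point. *)
Lemma all_fibres : M° !=set0 -> forall U pi kap b, chart p U pi kap -> U b ->
  good_fibre kap b.
Proof.
move=> iM U pi kap b ch Ub; have [oU cpi ckap kpi pik] := ch.
have cM : closed M by have [] := mM.
have cX y b' : U b' -> {for b', continuous (fun b => kap (b, y))}.
  move=> Ub'; apply: (@continuous_comp _ _ _ (fun b => (b, y)) kap); last exact: ckap.
  by apply: pair_continuous; [exact: cvg_id|exact: cst_continuous].
have key y : M (kap (b, y)) -> exists S : {set 'I_n},
    [/\ noend g S, S \subset fibre_full kap b & exists2 j, j \in S & (g j @` `[0,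
      1]) y].
  move=> My; set x := kap (b, y).
  have [px pix] := pik b y Ub.
  (* Only fullness of the edges of [S] depends on the fibre, and it survives limits; [noend] is a
     condition on [S] alone. *)
  pose K (S : {set 'I_n}) := [set x' | [/\ U (p x'), S \subset fibre_full kap (p x') &
    (\bigcup_(j in [set j | j \in S]) (g j @` `[0, 1])) (pi x')]].
  have [S [nS clS]] : exists S : {set 'I_n}, noend g S /\ closure (K S) x.
    apply: contrapT => nS.
    have nb (S : {set 'I_n}) : nbhs x [set x' | noend g S -> ~ K S x'].
      have [eS|neS] := pselect (noend g S); last first.
        by apply: filterS filterT => x' _.
      have ncl : ~ closure (K S) x by move=> c; apply: nS; exists S.
      have [A nA KA] : exists2 A, nbhs x A & ~ (K S `&` A !=set0).
        apply: contrapT => h; apply: ncl => A nA; apply: contrapT => h'; apply: h.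
        by exists A.
      by apply: filterS nA => x' Ax' _ Kx'; apply: KA; exists x'.
    have : nbhs x [set x' | (forall S : {set 'I_n}, noend g S -> ~ K S x') /\ U (p x')].
      apply: filterI; last first.
        by apply: (cp (x := x)); rewrite px; exact: open_nbhs_nbhs.
      exact: (@filter_forall _ _ (fun (S : {set 'I_n}) x' => noend g S -> ~ K S x')
        (nbhs x) _ nb).
    rewrite nbhsE => -[W [oW Wx] HW].
    (* [W] avoids all admissible [K S], there being finitely many [S]; semi-openness of [p] gives a
       generic fibre meeting [W], and its own set of full edges is a contradiction. *)
    have [V [oV V0 VW]] :=
      factor_semiopen cE cB hB cp cF cf pF mf mM pM oW (ex_intro _ x (conj My Wx)).
    have [b' Vb' gb'] := generic_fibre iM oV V0.
    have [x' [Mx' Wx'] x'b'] := VW b' Vb'.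
    have [nK Ux'] := HW x' Wx'.
    have Ub' : U b' by rewrite -x'b'.
    have [ne cov] := gb' _ _ _ ch Ub'.
    apply: (nK (fibre_full kap b')) => //; split => //; first by rewrite x'b'.
    have [|j jS jx] := cov (pi x'); first by rewrite -x'b' kpi.
    by exists j.
  exists S; split => //.
    apply/fintype.subsetP => j jS; rewrite inE; apply/asboolP => _ [t t01 <-] /=.
    apply: cM; rewrite -px => A nA.
    have nA' : nbhs x (fun x' => A (kap (p x', g j t))).
      have cc : {for x, continuous (fun x' => kap (p x', g j t))}.
        apply: (@continuous_comp _ _ _ p (fun b => kap (b, g j t))); first exact: cp.
        by apply: cX; rewrite px.
      exact: cc.
    have [x' [[Ux' /fintype.subsetP Sx' _] Ax']] := clS _ nA'.
    exists (kap (p x', g j t)); split => //.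
    by have := Sx' j jS; rewrite inE => /asboolP; apply; exists t.
  have cS : closed (\bigcup_(j in [set j | j \in S]) (g j @` `[0, 1]))
    by exact: edges_closed.
  rewrite -pix; suff [j jS jy] : (\bigcup_(j in [set j | j \in S]) (g j @` `[0,
    1])) (pi x) by exists j.
  apply: cS => A nA.
  have nA' : nbhs x (pi @^-1` A) by apply: cpi => //; rewrite px.
  have [x' [[_ _ Sx'] Ax']] := clS _ nA'.
  by exists (pi x').
split=> [j v jS vj|y My].
  (* The midpoint of edge [j] lies on no other edge, so the set [S] found for it contains [j] and
     supplies a second edge at [v]. *)
  have h01 : 0 < (1 / 2 : R) < 1 by lra.
  have Mj : M (kap (b, g j (1 / 2))).
    by move: jS; rewrite inE => /asboolP; apply; exists (1 / 2) => //=;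
      rewrite in_itv /=; lra.
  have [S [nS SS [j' j'S /(edge_inside gg h01) jj']]] := key _ Mj.
  rewrite -jj' in j'S; have [j'' [j''S j''j j''v]] := nS j v j'S vj.
  by exists j''; split => //; exact: (fintype.subsetP SS).
by have [S [_ SS [j jS jy]]] := key y My; exists j => //; exact: (fintype.subsetP SS).
Qed.

End Fibres.

(** * From star-like points of the fibres to interior points of [M] *)

Definition clamp (R : realType) (a b t : R) : R := Num.max a (Num.min b t).

Lemma clamp_continuous (R : realType) (a b : R) : continuous (clamp a b).
Proof.
move=> t; apply: (@continuous_max _ _ (fun=> a) (fun t => Num.min b t));
  first exact: cvg_cst.
by apply: continuous_min; [exact: cvg_cst|exact: cvg_id].
Qed.

Lemma clamp_in (R : realType) (a b t : R) : a <= b -> a <= clamp a b t <= b.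
Proof. by move=> ab; rewrite /clamp le_max lexx /= ge_max ab ge_min lexx. Qed.

Lemma clampK (R : realType) (a b t : R) : a <= t <= b -> clamp a b t = t.
Proof. by move=> /andP[at_ tb]; rewrite /clamp (min_idPr tb) (max_idPr at_). Qed.

Lemma star_interior_path (R : realType) (X : topologicalType) (Z : set X) (x : X) :
  @star_interior R X Z x -> exists (beta : R -> X) (e : R),
  [/\ 0 < e, continuous beta, beta 0 = x, (forall t, Z (beta t)) &
      forall s t, 0 <= s <= e -> 0 <= t <= e -> beta s = beta t -> s = t].
Proof.
move=> [Zx [A [oA Ax [n [n2 [h [[k [ch ck hk kh]] hx]]]]]]].
have h12 : 0 <= 1 / 2 :> R by lra.
(* The first ray of the star, cut at [1 / 2] because the open star omits its tips. *)
pose u t : R * R := (clamp 0 (1 / 2) t, 0).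
have uS t : open_star n (u t).
  exists 0%N, (clamp 0 (1 / 2) t); have /andP[c0 c1] := clamp_in t h12.
  split => //; [exact: leq_trans n2|lra|].
  by rewrite mulr0 mul0r cos0 sin0 mulr0 mulr1.
have cu : continuous u.
  move=> t; apply: pair_continuous; [exact: clamp_continuous|exact: cst_continuous].
exists (k \o u), (1 / 2); split.
- lra.
- exact: within_continuous_comp_in ck cu uS.
- have [_ <-] := hk x (conj Zx Ax); rewrite hx /= /u clampK //; lra.
- by move=> t; have [[]] := kh _ (uS t).
- move=> s t s01 t01 /= st.
  have [_ us] := kh _ (uS s); have [_ ut] := kh _ (uS t).
  by have := ut; rewrite -st us /u !clampK // => -[].
Qed.

Section EndDense.
Variables (R : realType) (E B : uniformType) (G : topologicalType).
Variables (n : nat) (g : 'I_n -> R -> G).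
Variables (p : E -> B) (F : E -> E) (f : B -> B) (M : set E).
Hypotheses (cE : compact [set: E]) (hE : hausdorff_space E).
Hypotheses (cB : compact [set: B]) (hB : hausdorff_space B).
Hypotheses (hG : hausdorff_space G) (gg : graph_edges g).
Hypotheses (cp : continuous p) (cF : continuous F) (cf : continuous f).
Hypotheses (pF : forall x, p (F x) = f (p x)).
Hypotheses (mf : minimal_set f [set: B]) (mM : minimal_set F M).
Hypothesis pM : p @` M = [set: B].
Hypothesis charts : forall b, exists (U : set B) (pi : E -> G) (k : B * G -> E),
  U b /\ chart p U pi k.

(** Some inner parameter of the arc is not sent to a vertex. Near it the edge coordinate is
    continuous and takes two distinct values, so it covers an interval, in which rational ends can
    be chosen. *)
Lemma path_covers_subedge (pi : R -> G) (e : R) : 0 < e -> continuous pi ->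
  (forall s t, 0 <= s <= e -> 0 <= t <= e -> pi s = pi t -> s = t) ->
  exists (i : 'I_n) (q1 q2 : rat), [/\ 0 < (ratr q1 : R), ratr q1 < (ratr q2 : R),
    ratr q2 < (1 : R) &
    forall c, ratr q1 <= c <= ratr q2 -> exists2 t, 0 <= t <= e & pi t = g i c].
Proof.
move=> e0 cpi ipi.
have [cg _ cov _] := gg.
have [t0 [t0e [i [c0 c01 c0E]]]] : exists t0, 0 < t0 < e /\
    exists i, exists2 c, 0 < c < 1 & g i c = pi t0.
  set v := pi (e / 2).
  (* Near [v] there is no vertex other than [v], and by injectivity another point of the arc is not
     [v] either. *)
  pose C := (\bigcup_(i in [set i | g i 0 <> v]) (g i @` `[0, 0])) `|`
    (\bigcup_(i in [set i | g i 1 <> v]) (g i @` `[1, 1])).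
  have cC : closed C by apply: closedU; exact: edges_closed.
  have nCv : ~ C v.
    by move=> [[i /= iv]|[i /= iv]] [t /=]; rewrite in_itv /= -eq_le => /eqP <-.
  have /nbhs_ballP [d /= d0 hd] : nbhs (e / 2) (pi @^-1` (~` C)).
    by apply: cpi; apply: open_nbhs_nbhs; split => //; exact: closed_openC.
  pose t0 := e / 2 + Num.min d (e / 2) / 2.
  have [ht1 ht2 ht3] : [/\ e / 2 < t0, t0 < e & t0 < e / 2 + d].
    by rewrite /t0; case: (leP d (e / 2)) => ?; split; lra.
  exists t0; split; first by lra.
  have nC : ~ C (pi t0) by apply: hd; rewrite /ball /= ltr_distl; lra.
  have [i [c /=]] := cov (pi t0); rewrite in_itv /= => c01 ct0.
  have nv : pi t0 <> v.
    by move=> /ipi h; have {}h : t0 = e / 2 by [apply: h; lra]; lra.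
  exists i, c => //.
  have c0 : c != 0.
    apply/eqP => c0; apply: nC; left; exists i; first by rewrite /= -c0 ct0.
    exists 0; last by rewrite -ct0 c0.
    by rewrite /= in_itv /= lexx.
  have c1 : c != 1.
    apply/eqP => c1; apply: nC; right; exists i; first by rewrite /= -c1 ct0.
    exists 1; last by rewrite -ct0 c1.
    by rewrite /= in_itv /= lexx.
  by lra.
have egi : edge (g i) by exact: graph_edge.
have oI : open (g i @` `]0, 1[) by case: egi.
have /nbhs_ballP [d /= d0 hd] : nbhs t0 (pi @^-1` (g i @` `]0, 1[)).
  apply: cpi; apply: open_nbhs_nbhs; split => //; rewrite -c0E.
  by exists c0 => //=; rewrite in_itv.
pose t1 := t0 + Num.min d (e - t0) / 2.
have [t01 t1e t1d] : [/\ t0 < t1, t1 < e & t1 < t0 + d].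
  by rewrite /t1; case: (leP d (e - t0)) => ?; split; lra.
have inside t : t \in `[t0, t1] -> exists2 c, 0 < c < 1 & g i c = pi t.
  rewrite in_itv /= => tt; have [|c /=] := hd t; first by rewrite /ball /=
    ltr_distl; lra.
  by rewrite in_itv /=; exists c.
have cphi : {within `[t0, t1], continuous (edge_coord (g i) \o pi)}.
  apply: continuous_in_subspaceT => t /[!inE] /inside [c c01' cE'].
  by apply: continuous_comp; [exact: cpi|rewrite -cE'; exact: edge_coord_cvg].
have h1 : t1 \in `[t0, t1] by rewrite in_itv /= lexx ltW.
have [c1 c101 c1E] := inside t1 h1.
have phi0 : edge_coord (g i) (pi t0) = c0 by rewrite -c0E edge_coordK //; lra.
have phi1 : edge_coord (g i) (pi t1) = c1 by rewrite -c1E edge_coordK //; lra.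
have c01ne : c0 != c1.
  apply/eqP => c01e; have h : pi t0 = pi t1 by rewrite -c0E -c1E c01e.
  by have {}h : t0 = t1 by [apply: ipi h; lra]; lra.
have [a [b [ab a0 b1 abE]]] : exists a b : R, [/\ a < b, 0 < a, b < 1 &
    forall c, a < c < b -> Num.min c0 c1 <= c <= Num.max c0 c1].
  by move: c01ne; case: (ltgtP c0 c1) => // h _; [exists c0, c1|exists c1, c0];
    split => //; try lra; move=> c; lra.
have [q1] := rat_in_itvoo ab; rewrite in_itv /= => /andP[aq1 q1b].
have [q2] := rat_in_itvoo q1b; rewrite in_itv /= => /andP[q12 q2b].
exists i, q1, q2; split => //; [lra|lra|].
move=> c cq; have cab : a < c < b by lra.
have [|t tt /= tc] := @IVT R (edge_coord (g i) \o pi) t0 t1 c (ltW t01) cphi.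
  by rewrite /= phi0 phi1; exact: abE.
have [c' c'01 c'E] := inside t tt.
exists t; first by move: tt; rewrite in_itv /=; lra.
by move: tc; rewrite -c'E edge_coordK //; [move=> ->|lra].
Qed.

(** Each fibre over some open set of the base contains a rational subarc of an edge. These are
    countably many, so by Baire one of them lies in all fibres over an open set, which gives an open
    box in [M]. *)
Lemma star_interior_solid (O : set E) : open O -> M `&` O !=set0 ->
  (forall x, M x -> O x -> @star_interior R E (M `&` p @^-1` [set p x]) x) ->
  M° !=set0.
Proof.
move=> oO [x0 [Mx0 Ox0]] starO.
have [U [pi [kap [Ux0 ch]]]] := charts (p x0).
have [oU cpi ckap kpi pik] := ch; have [cg _ _ _] := gg.
have cM : closed M by have [] := mM.
have oOU : open (O `&` p @^-1` U).
  by apply: openI => //; apply: open_comp => // x _; exact: cp.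
have MOU : M `&` (O `&` p @^-1` U) !=set0 by exists x0.
have [V [oV [v Vv] VO]] := factor_semiopen cE cB hB cp cF cf pF mf mM pM oOU MOU.
have VU : V `<=` U by move=> b /VO [x [_ [_ Ux]] <-].
have [V' [oV' V'v cV']] := regular_shrink oV Vv.
pose N (q : 'I_n * rat * rat) : set B := closure V' `&` [set b |
  [/\ 0 < (ratr q.1.2 : R), ratr q.1.2 < (ratr q.2 : R), ratr q.2 < (1 : R) &
    forall c : R, ratr q.1.2 <= c <= ratr q.2 -> M (kap (b, g q.1.1 c))]].
have cN q : closed (N q).
  move=> b clb.
  have Vb : closure V' b.
    by apply: (@closed_closure _ V'); apply: closureS clb => b' [].
  have [b' [[_ [h1 h2 h3 _]] _]] := clb _ filterT.
  split => //; split => // c cq; apply: cM => A nA.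
  have nA' : nbhs b (fun b => A (kap (b, g q.1.1 c))).
    have cc : {for b, continuous (fun b => kap (b, g q.1.1 c))}.
      apply: (@continuous_comp _ _ _ (fun b => (b, g q.1.1 c)) kap).
        by apply: pair_continuous; [exact: cvg_id|exact: cst_continuous].
      by apply: ckap; apply: VU; exact: cV'.
    exact: cc.
  have [b'' [[_ [_ _ _ Mb'']] Ab'']] := clb _ nA'.
  by exists (kap (b'', g q.1.1 c)); split => //; exact: Mb''.
have [q [b iNb]] : exists q, (N q)° !=set0.
  apply: contrapT => nq.
  have iN q : (N q)° = set0.
    by apply/eqP/negPn/negP => /set0P ne; apply: nq; exists q.
  have [b [V'b Nb]] := baire_countable cB cN iN oV' (ex_intro _ v V'v).
  have [x [Mx [Ox Ux]] xb] := VO b (cV' _ (subset_closure V'b)).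
  have [beta [e [e0 cbeta beta0 Zbeta ibeta]]] := star_interior_path (starO x Mx Ox).
  have pbeta t : p (beta t) = b by have [_ /= ->] := Zbeta t.
  have Ub : U b by rewrite -xb.
  have [||i [q1 [q2 [q10 q12 q21 cov]]]] := @path_covers_subedge (pi \o beta) e e0.
  - by move=> t; apply: continuous_comp; [exact: cbeta|apply: cpi; rewrite pbeta].
  - move=> s t se te /= st; apply: ibeta => //.
    by rewrite -[beta s]kpi ?pbeta // st -(pbeta t) kpi // pbeta.
  apply: (Nb (i, q1, q2)); split; first exact: subset_closure.
  split => // c /cov [t te /= <-].
  by rewrite -(pbeta t) kpi ?pbeta //; have [] := Zbeta t.
have [_ [h1 h2 h3 _]] := interior_subset iNb.
have iNU : (N q)° `<=` U.
  by move=> b' /interior_subset [/cV' Vb' _]; exact: VU.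
have egi : edge (g q.1.1) by exact: graph_edge.
have oQ := box_open hG cp ch egi (open_interior (N q)) iNU (ltW h1) (ltW h3).
pose u : R := ratr q.1.2; pose w : R := ratr q.2; pose m : R := (u + w) / 2.
have mid : u < m < w by have : u < w := h2; rewrite /m; lra.
have [pE piE] := pik b (g q.1.1 m) (iNU _ iNb).
exists (kap (b, g q.1.1 m)).
rewrite /interior nbhsE; eexists; first split; first exact: oQ.
  by split; rewrite ?pE // piE; eexists; [|reflexivity]; rewrite /= in_itv.
move=> x [/interior_subset [/cV' /VU Ux [_ _ _ MN]] [c /=]]; rewrite in_itv /= => cq cx.
by rewrite -(kpi x Ux) -cx; apply: MN; lra.
Qed.

End EndDense.

(** * Stars and circles *)

Section Glue.
Variables (R : realType).

(** Points of the arcs sent outside an open set form a finite union of compact images, hence a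
    closed set. The given element of [Y] is the value off the arcs. *)
Lemma glue_map (X Y : topologicalType) (I : finType) (beta : I -> R -> X) (rho :
  I -> R -> Y) :
  hausdorff_space X -> Y ->
  (forall i, continuous (beta i)) -> (forall i, continuous (rho i)) ->
  (forall i j s t, 0 <= s <= 1 -> 0 <= t <= 1 -> beta i s = beta j t -> rho i s =
    rho j t) ->
  exists2 h : X -> Y, {within \bigcup_i (beta i @` `[0, 1]), continuous h} &
    forall i t, 0 <= t <= 1 -> h (beta i t) = rho i t.
Proof.
move=> hX y0 cb cr ker.
have /choice [h hP] : forall x, exists y, forall i t, 0 <= t <= 1 -> beta i t =
  x -> y = rho i t.
  move=> x; have [[i [t [t01 tx]]]|nx] := pselect (exists i t, 0 <= t <=
    1 /\ beta i t = x).
    exists (rho i t) => j s s01 sx; apply: ker => //; by rewrite tx.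
  by exists y0 => i t t01 tx; case: nx; exists i, t.
exists h; last by move=> i t t01; exact: hP.
apply/subspace_continuousP => x Ax W nW.
have [W' [oW' W'x W'W]] : exists W', [/\ open W', W' (h x) & W' `<=` W].
  by move: nW; rewrite nbhsE => -[W' [? ?] ?]; exists W'.
pose C := \bigcup_(i in [set: I]) (beta i @` (`[0, 1] `&` rho i @^-1` (~` W'))).
have cC : closed C.
  apply: closed_bigcup => [|i _]; first exact: finite_finset.
  apply: compact_closed => //; apply: continuous_compact.
    exact: continuous_subspaceT.
  apply: compact_closedI; first exact: segment_compact.
  apply: preimage_closed => [z _|]; [exact: cr|exact: open_closedC].
have nCx : ~ C x.
  move=> [i _ [t [/=]]]; rewrite in_itv /= => t01 nW' tx; apply: nW'.
  by rewrite -(hP x i t t01 tx).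
have : nbhs x (~` C) by apply: open_nbhs_nbhs; split => //; exact: closed_openC.
apply: filterS => z nCz [i _ [t /=]]; rewrite in_itv /= => t01 tz.
apply: W'W; apply: contrapT => nW'; apply: nCz; exists i => //.
exists t => //; split; first by rewrite /= in_itv.
by rewrite /= -(hP z i t t01 tz).
Qed.

(** Serves both stars and circles: it is enough to compare which parameters coincide in the two
    families of paths. *)
Lemma glue_homeo (X Y : topologicalType) (I : finType) (beta : I -> R -> X) (rho :
  I -> R -> Y) :
  hausdorff_space X -> hausdorff_space Y -> X -> Y ->
  (forall i, continuous (beta i)) -> (forall i, continuous (rho i)) ->
  (forall i j s t, 0 <= s <= 1 -> 0 <= t <= 1 -> beta i s = beta j t <-> rho i s =
    rho j t) ->
  exists2 h, homeo_on (\bigcup_i (beta i @` `[0, 1])) (\bigcup_i (rho i @` `[0, 1])) h &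
    forall i t, 0 <= t <= 1 -> h (beta i t) = rho i t.
Proof.
move=> hX hY x0 y0 cb cr ker.
have [|h ch hE] := @glue_map X Y I beta rho hX y0 cb cr.
  by move=> i j s t s01 t01; move/ker; apply.
have [|k ck kE] := @glue_map Y X I rho beta hY x0 cr cb.
  by move=> i j s t s01 t01; move/ker; apply.
exists h => //; exists k; split => //.
- move=> _ [i _ [t /= t01' <-]]; have t01 : 0 <= t <= 1 by move: t01'; rewrite in_itv.
  by rewrite hE // kE //; split => //; exists i => //; exists t.
- move=> _ [i _ [t /= t01' <-]]; have t01 : 0 <= t <= 1 by move: t01'; rewrite in_itv.
  by rewrite kE // hE //; split => //; exists i => //; exists t.
Qed.

Lemma homeo_on_sub (X Y : topologicalType) (A A' : set X) (C C' : set Y) (h : X -> Y) :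
  homeo_on A C h -> A' `<=` A -> h @` A' = C' -> homeo_on A' C' h.
Proof.
move=> [k [ch ck hk kh]] AA <-; exists k; split.
- exact: continuous_subspaceW ch.
- by apply: continuous_subspaceW ck => _ [x A'x <-]; have [] := hk x (AA _ A'x).
- by move=> x A'x; split; [exists x|have [] := hk x (AA _ A'x)].
- by move=> _ [x A'x <-]; have [_ ->] := hk x (AA _ A'x).
Qed.

(** The difference has cosine [1]; since [cos] is injective on [[0, pi]] only, a difference above
    [pi] is replaced by its complement to a full turn. *)
Lemma angle_inj (a b : R) : 0 <= a < pi *+ 2 -> 0 <= b < pi *+ 2 ->
  cos a = cos b -> sin a = sin b -> a = b.
Proof.
wlog ab : a b / a <= b => [H a2 b2 c s|].
  have [ab|/ltW ba] := leP a b; first exact: H.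
  by apply/esym; apply: H.
move=> a2 b2 cab sab.
have c1 : cos (b - a) = 1 by rewrite cosB cab sab -!expr2 cos2Dsin2.
have pi0 := pi_gt0 R.
have [h|h] := leP (b - a) pi.
  have : b - a = 0.
    by apply: cos_inj; rewrite ?in_itv /= ?cos0 //; lra.
  by lra.
have : cos (pi *+ 2 - (b - a)) =
  cos 0 by rewrite cosB cos2pi sin2pi c1 mulr1 mul0r addr0 cos0.
by move/cos_inj; rewrite !in_itv /= => h0; have {}h0 : pi *+ 2 - (b - a) =
  0 by [apply: h0; lra]; lra.
Qed.

Definition ray m (j : 'I_m) (t : R) : R * R :=
  (t * cos (2 * pi * j%:R / m%:R), t * sin (2 * pi * j%:R / m%:R)).

Lemma ray_continuous m (j : 'I_m) : continuous (@ray m j).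
Proof.
have cM (c : R) : continuous (fun t : R => t * c).
  by move=> t; apply: cvgM; [exact: cvg_id|exact: cvg_cst].
by move=> t; exact: pair_continuous (cM _ t) (cM _ t).
Qed.

Lemma ray_inj m (i j : 'I_m) s t : 0 <= s -> 0 <= t -> ray i s = ray j t <->
  s = t /\ (s = 0 \/ i = j).
Proof.
move=> s0 t0; split=> [[]|[<- [->|->]//]]; last by rewrite /ray !mul0r.
set a := 2 * pi * i%:R / m%:R; set b := 2 * pi * j%:R / m%:R => cst sst.
have st : s = t.
  apply/eqP; rewrite -(@eqrXn2 _ 2) //.
  have : (s * cos a) ^+ 2 + (s * sin a) ^+ 2 = (t * cos b) ^+ 2 + (t * sin b) ^+ 2.
    by rewrite cst sst.
  by rewrite !exprMn -!mulrDr !cos2Dsin2 !mulr1 => ->.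
split => //; have [|sn0] := eqVneq s 0; [by left|right].
rewrite -st in cst sst.
have ca : cos a = cos b by exact: (mulfI sn0).
have sa : sin a = sin b by exact: (mulfI sn0).
have m0 : 0 < (m%:R : R) by rewrite ltr0n; exact: leq_trans (ltn_ord i).
have pi0 := pi_gt0 R.
have range (k : 'I_m) : 0 <= (2 * pi * k%:R / m%:R : R) < pi *+ 2.
  apply/andP; split.
    by rewrite divr_ge0 ?ler0n // mulr_ge0 ?ler0n // mulr_ge0 // ltW.
  rewrite ltr_pdivrMr //.
  have km : 0 < (m%:R : R) - k%:R by rewrite subr_gt0 ltr_nat.
  by have := mulr_gt0 pi0 km; lra.
have : a = b by apply: angle_inj => //; exact: range.
move/(congr1 (fun x => x * m%:R)); rewrite /a /b !divfK ?lt0r_neq0 //.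
have p2 : 2 * pi != (0 : R) by rewrite mulf_neq0 // lt0r_neq0.
by move/(mulfI p2)/eqP; rewrite eqr_nat => /eqP /val_inj.
Qed.

Lemma open_starE m : open_star m = \bigcup_(j in [set: 'I_m]) (ray j @` `[0%R,
  1%R[%classic) :> set (R * R).
Proof.
apply/seteqP; split => [z [j [t [jm t0 t1 ->]]]|z [j _ [t /=]]].
  by exists (Ordinal jm) => //; exists t => //=; rewrite in_itv /= t0.
by rewrite in_itv /= => /andP[t0 t1] <-; exists j, t.
Qed.

Lemma prod_R_hausdorff : hausdorff_space (R * R)%type.
Proof. exact: norm_hausdorff. Qed.

(** Star-likeness expressed by arcs, which pass through charts easily. They are injective up to the
    closed end [1], so that compact gluing applies; the tips are dropped only in the last clause. *)
Definition branching (X : topologicalType) (Z : set X) (x : X) :=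
  exists (m : nat) (beta : 'I_m -> R -> X) (A : set X),
  [/\ (2 <= m)%N, open A /\ (forall j, continuous (beta j)), forall j, beta j 0 = x,
      (forall i j s t, 0 <= s <= 1 -> 0 <= t <= 1 -> beta i s = beta j t ->
        s = t /\ (s = 0 \/ i = j)) &
      Z `&` A = \bigcup_(j in [set: 'I_m]) (beta j @` `[0, 1[)].

Lemma branching_star_interior (X : topologicalType) (Z : set X) (x : X) :
  hausdorff_space X -> branching Z x -> @star_interior R X Z x.
Proof.
move=> hX [m [beta [A [m2 [oA cb] b0 ker ZA]]]].
have m0 : (0 < m)%N by exact: leq_trans m2.
have [Zx Ax] : (Z `&` A) x.
  rewrite ZA; exists (Ordinal m0) => //; exists 0; last exact: b0.
  by rewrite /= in_itv /= lexx ltr01.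
have ker' (i j : 'I_m) s t : 0 <= s <= 1 -> 0 <= t <= 1 ->
    beta i s = beta j t <-> @ray m i s = @ray m j t.
  move=> s01 t01; rewrite ray_inj; [|by case/andP: s01|by case/andP: t01].
  by split=> [/ker|[<- [s0|->//]]]; [exact|rewrite s0 !b0].
have [h hh hE] := glue_homeo hX prod_R_hausdorff x (0, 0) cb (@ray_continuous m) ker'.
split => //; exists A; split => //; exists m; split => //; exists h; split; last first.
  by rewrite -(b0 (Ordinal m0)) hE ?lexx ?ler01 // /ray !mul0r.
rewrite ZA open_starE; apply: homeo_on_sub hh _ _.
  move=> z [j _ [t /=]]; rewrite in_itv /= => /andP[t0 t1] tz.
  by exists j => //; exists t => //=; rewrite in_itv /= t0 ltW.
apply/seteqP; split => [_ [_ [j _ [t t01 <-]] <-]|_ [j _ [t t01 <-]]].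
  exists j => //; exists t => //; rewrite hE //.
  by move: t01; rewrite /= in_itv /= => /andP[-> /ltW].
exists (beta j t); first by exists j => //; exists t.
by rewrite hE //; move: t01; rewrite /= in_itv /= => /andP[-> /ltW].
Qed.

Definition half_circle (j : bool) (t : R) : R * R :=
  (cos (pi * t), if j then sin (pi * t) else - sin (pi * t)).

Lemma half_circle_continuous j : continuous (half_circle j).
Proof.
have cpi : continuous (fun t : R => pi * t).
  by move=> t; apply: cvgM; [exact: cvg_cst|exact: cvg_id].
move=> t.
have cc : {for t, continuous (fun t : R => cos (pi * t))}.
  apply: (@continuous_comp _ _ _ (fun t : R => pi * t) cos); first exact: cpi.
  exact: continuous_cos.
have cs : {for t, continuous (fun t : R => sin (pi * t))}.
  apply: (@continuous_comp _ _ _ (fun t : R => pi * t) sin); first exact: cpi.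
  exact: continuous_sin.
case: j; first exact: pair_continuous cc cs.
by apply: pair_continuous cc _; exact: cvgN.
Qed.

Lemma half_circle_inj i j s t : 0 <= s <= 1 -> 0 <= t <= 1 ->
  half_circle i s = half_circle j t <-> s = t /\ (s = 0 \/ s = 1 \/ i = j).
Proof.
move=> s01 t01; have pi0 := pi_gt0 R; split=> [[cst sst]|[<-]]; last first.
  by case=> [->|[->|->//]]; rewrite /half_circle ?mulr0 ?mulr1 ?sin0 ?sinpi oppr0;
    case: i; case: j.
have st : s = t.
  have h : pi * s = pi * t.
    have range (u : R) : 0 <= u <= 1 -> pi * u \in `[0, pi].
      move=> /andP[u0 u1]; rewrite in_itv /=; apply/andP; split.
        exact: mulr_ge0 (ltW pi0) u0.
      by rewrite ger_pMr.
    by apply: cos_inj => //; exact: range.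
  by apply: (mulfI _ h); rewrite lt0r_neq0.
split => //; have [->|s0] := eqVneq s 0; [by left|right].
have [->|s1] := eqVneq s 1; [by left|right].
have sp : 0 < sin (pi * s).
  apply: sin_gt0_pi; apply/andP; split; first by apply: mulr_gt0 => //; lra.
  by rewrite gtr_pMr //; lra.
by move: sst; rewrite -st; case: (i); case: (j) => //; lra.
Qed.

Lemma unit_circleE : @unit_circle R = \bigcup_(j in [set: bool])
  (half_circle j @` `[0, 1]).
Proof.
have pi0 := pi_gt0 R.
apply/seteqP; split => [[x y] xy|_ [j _ [t _ <-]]]; last first.
  by rewrite /unit_circle /half_circle /=; case: j; rewrite ?sqrrN cos2Dsin2.
have {}xy : x ^+ 2 + y ^+ 2 = 1 by exact: xy.
have x1 : -1 <= x <= 1 by have := sqr_ge0 y; nra.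
have [a0 ax] := acos_def x1.
have y2 : y ^+ 2 = sin (acos x) ^+ 2 by rewrite sin2cos2 ax -xy; ring.
have : y = sin (acos x) \/ y = - sin (acos x).
  by move/eqP: y2; rewrite eqf_sqr => /orP[]/eqP; [left|right].
have t01 : `[0%R, 1%R]%classic (acos x / pi).
  by rewrite /= in_itv /= divr_ge0 ?ler_pdivrMr ?mul1r //; case/andP: a0 => // _ _;
    exact: ltW.
have pit : pi * (acos x / pi) = acos x by rewrite mulrC divfK // lt0r_neq0.
by case=> ->; [exists true|exists false] => //; exists (acos x / pi) => //;
  rewrite /half_circle pit ax.
Qed.

Lemma two_arcs_circle (X : topologicalType) (beta : bool -> R -> X) :
  hausdorff_space X -> (forall j, continuous (beta j)) ->
  (forall i j s t, 0 <= s <= 1 -> 0 <= t <= 1 -> beta i s = beta j t <->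
    s = t /\ (s = 0 \/ s = 1 \/ i = j)) ->
  exists C : set X, @is_circle R X C.
Proof.
move=> hX cb ker.
have ker' (i j : bool) s t : 0 <= s <= 1 -> 0 <= t <= 1 ->
    beta i s = beta j t <-> half_circle i s = half_circle j t.
  by move=> s01 t01; rewrite half_circle_inj //; exact: ker.
have [h hh _] := glue_homeo hX prod_R_hausdorff (beta true 0) (0, 0)
  cb half_circle_continuous ker'.
by exists (\bigcup_j (beta j @` `[0, 1])), h; rewrite unit_circleE.
Qed.

End Glue.

(** * Stars in unions of edges without free ends *)

Section Branches.
Variables (R : realType) (G : topologicalType) (n : nat) (g : 'I_n -> R -> G).
Hypotheses (hG : hausdorff_space G) (gg : graph_edges g).

Lemma edges_meet i j s t : i != j -> 0 <= s <= 1 -> 0 <= t <= 1 -> g i s = g j t ->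
  vertex_of g (g i s) i /\ vertex_of g (g j t) j.
Proof.
have [_ _ _ cross] := gg => ij s01 t01 st.
by have [[->|->] [->|->]] := cross _ _ _ _ ij s01 t01 st; split; by [left|right].
Qed.

Lemma branching_inner (H : set G) i c : 0 < c < 1 -> g i @` `[0, 1] `<=` H ->
  branching R H (g i c).
Proof.
move=> c01 iH; have egi := graph_edge hG gg i; have [cgi igi _] := egi.
(* Half the distance to the nearer end, so that both arms stay inside the open edge. *)
pose d := Num.min c (1 - c) / 2.
have [d0 dc dc1] : [/\ 0 < d, 0 < c - d & c + d < 1].
  by rewrite /d; case: (leP c (1 - c)) => ?; split; lra.
pose sg (j : 'I_2) : R := if val j == 0%N then 1 else -1.
have sgP j : sg j = 1 \/ sg j = -1 by rewrite /sg; case: ifP; [left|right].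
have sg_inj j k : sg j = sg k -> j = k.
  move: j k => [[|[|//]] jj] [[|[|//]] kk]; rewrite /sg /= => h; try by exfalso; lra.
    exact: val_inj.
  exact: val_inj.
exists 2%N, (fun j t => g i (c + sg j * (d * t))), (g i @` `](c - d), (c + d)[);
  split => //.
- split; first by apply: edge_open => //; lra.
  move=> j t; apply: (@continuous_comp _ _ _ (fun t => c + sg j * (d * t)) (g i));
    last exact: cgi.
  apply: cvgD; first exact: cvg_cst.
  by apply: cvgM; [exact: cvg_cst|apply: cvgM; [exact: cvg_cst|exact: cvg_id]].
- by move=> j; rewrite !mulr0 addr0.
- move=> j k s t s01 t01 h.
  have ds : 0 <= d * s <= d by apply/andP; split; nra.
  have dt : 0 <= d * t <= d by apply/andP; split; nra.
  have {}h : c + sg j * (d * s) = c + sg k * (d * t).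
    by apply: igi h; [case: (sgP j) => ->; lra|case: (sgP k) => ->; lra].
  have d0' : d != 0 by rewrite lt0r_neq0.
  have [js|js] := sgP j; have [ks|ks] := sgP k; rewrite js ks in h.
  + have {}h : d * s = d * t by lra.
    by split; [exact: (mulfI d0')|right; apply: sg_inj; rewrite js ks].
  + have hs : d * s = 0 by lra.
    have ht : d * t = 0 by lra.
    move/eqP: hs; rewrite mulf_eq0 (negbTE d0') /= => /eqP ->.
    by move/eqP: ht; rewrite mulf_eq0 (negbTE d0') /= => /eqP ->; split => //; left.
  + have hs : d * s = 0 by lra.
    have ht : d * t = 0 by lra.
    move/eqP: hs; rewrite mulf_eq0 (negbTE d0') /= => /eqP ->.
    by move/eqP: ht; rewrite mulf_eq0 (negbTE d0') /= => /eqP ->; split => //; left.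
  + have {}h : d * s = d * t by lra.
    by split; [exact: (mulfI d0')|right; apply: sg_inj; rewrite js ks].
- apply/seteqP; split => [x [_ [s /=]]|x [j _ [t /=]]]; rewrite in_itv /= => sI <-.
    have [cs|sc] := leP c s.
      exists ord0 => //; exists ((s - c) / d) => /=.
        by rewrite in_itv /= divr_ge0 ?ltr_pdivrMr; lra.
      by rewrite /sg /= mul1r mulrC divfK ?lt0r_neq0 // addrC subrK.
    exists (lift ord0 ord0) => //; exists ((c - s) / d) => /=.
      by rewrite in_itv /= divr_ge0 ?ltr_pdivrMr; lra.
    by rewrite /sg /= [d * _]mulrC divfK ?lt0r_neq0 //; congr (g i _); lra.
  have dt : 0 <= d * t < d by apply/andP; split; nra.
  have cI : c - d < c + sg j * (d * t) < c + d by case: (sgP j) => ->; lra.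
  split; last by exists (c + sg j * (d * t)) => //=; rewrite in_itv.
  by apply: iH; exists (c + sg j * (d * t)) => //=; rewrite in_itv /=; lra.
Qed.

(** The branches are the first halves of the edges of [S] at [v]. Halving matters: two edges may
    also share their other end, where whole edges would meet again. *)
Lemma branching_vertex (S : {set 'I_n}) (H : set G) j0 v : noend g S ->
  H = \bigcup_(j in [set j | j \in S]) (g j @` `[0, 1]) ->
  j0 \in S -> vertex_of g v j0 -> branching R H v.
Proof.
move=> nS HE j0S vj0; have [cg ig cov cross] := gg.
have half_lt1 (t : R) : t < 1 -> t / 2 < 1 / 2 by move=> ?; lra.
pose P : {set 'I_n} := [set j in S | `[< vertex_of g v j >]].
have PP j : j \in P -> j \in S /\ vertex_of g v j.
  by rewrite inE => /andP[? /asboolP ?].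
have inP j : j \in S -> vertex_of g v j -> j \in P.
  by move=> jS vj; rewrite inE jS; apply/asboolP.
have /choice [gm gmP] : forall j, exists gm : R -> G, vertex_of g v j ->
    [/\ edge gm, gm 0 = v, gm @` `[0, 1] = g j @` `[0, 1] & gm 1 != v /\
      (forall u, vertex_of g u j <-> u = gm 0 \/ u = gm 1)].
  move=> j; have [vj|nvj] := pselect (vertex_of g v j); last by exists (g j).
  by have [gm gmP] := vertex_orient hG gg vj; exists gm.
have P2 : (2 <= #|P|)%N.
  have [j1 [j1S j10 vj1]] := nS j0 v j0S vj0.
  have vj1' := vertex_of_mem gg vj0 vj1.
  rewrite (cardsD1 j0) inP // (cardsD1 j1) !inE j10 j1S /=.
  by have -> : `[< vertex_of g v j1 >] by apply/asboolP.
have meet j l s t : j \in P -> l \in P -> j != l -> 0 <= s <= 1 -> 0 <= t <= 1 ->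
    gm j s = gm l t -> (s = 0 \/ s = 1) /\ (t = 0 \/ t = 1).
  move=> /PP[_ vj] /PP[_ vl] jl s01 t01 st.
  have [ej j0' jE [j1 jV]] := gmP j vj; have [el l0' lE [l1 lV]] := gmP l vl.
  have [s' s'01 s'E] : (g j @` `[0, 1]) (gm j s) by rewrite -jE; exists s => //=;
    rewrite in_itv.
  have [t' t'01 t'E] : (g l @` `[0, 1]) (gm l t) by rewrite -lE; exists t => //=;
    rewrite in_itv.
  move: s'01 t'01; rewrite /= !in_itv /= => s'01 t'01.
  have h : g j s' = g l t' by rewrite s'E t'E.
  have [] := edges_meet jl s'01 t'01 h; rewrite s'E t'E => /jV sv /lV tv.
  have [_ ij _] := ej; have [_ il _] := el.
  have h0 : 0 <= (0 : R) <= 1 by lra.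
  have h1 : 0 <= (1 : R) <= 1 by lra.
  split.
    by case: sv => /ij hs; [left|right]; exact: hs.
  by case: tv => /il ht; [left|right]; exact: ht.
have gm1 j : j \in P -> gm j 1 <> v by move=> /PP[_ /gmP [_ _ _ [/eqP]]].
have gm0 j : j \in P -> gm j 0 = v by move=> /PP[_ /gmP []].
have gmi j : j \in P -> edge (gm j) by move=> /PP[_ /gmP []].
(* Off [C], all that remains of [H] is the inner halves of its edges at [v]. *)
pose C := \bigcup_(j in [set j | j \in P]) (gm j @` `[1 / 2, 1]) `|`
  \bigcup_(j in [set j | ~ (g j @` `[0, 1]) v]) (g j @` `[0, 1]).
have cC : closed C.
  apply: closedU; last exact: edges_closed.
  apply: closed_bigcup => [|j /gmi [cj _ _]]; first exact: finite_finset.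
  exact: path_closed.
exists #|P|, (fun i t => gm (enum_val i) (t / 2)), (~` C); split => //.
- split; first exact: closed_openC.
  move=> i t; have [cj _ _] := gmi _ (enum_valP i).
  apply: (@continuous_comp _ _ _ (fun t : R => t / 2) (gm (enum_val i)));
    last exact: cj.
  by apply: cvgM; [exact: cvg_id|exact: cvg_cst].
- by move=> i; rewrite mul0r gm0 //; exact: enum_valP.
- move=> i l s t s01 t01 h.
  have s2 : 0 <= s / 2 <= 1 by lra.
  have t2 : 0 <= t / 2 <= 1 by lra.
  have [il|il] := eqVneq i l.
    rewrite -il in h; have [_ ii _] := gmi _ (enum_valP i).
    have {}h : s / 2 = t / 2 by exact: ii.
    by split; [lra|right].
  have il' : enum_val i != enum_val l by apply: contra_neq il; exact: enum_val_inj.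
  have [] := meet _ _ _ _ (enum_valP i) (enum_valP l) il' s2 t2 h.
  by move=> hs ht; split; [|left]; lra.
- apply/seteqP; split => [x [Hx nCx]|x [i _ [t /=]]].
    move: Hx; rewrite HE => -[j jS jx].
    have vj : (g j @` `[0, 1]) v.
      by apply: contrapT => h; apply: nCx; right; exists j.
    have jP : j \in P by apply: inP => //; exact: vertex_of_mem vj0 vj.
    have [_ /gmP [_ _ jE _]] := PP j jP.
    move: (jx); rewrite -jE => -[s /=]; rewrite in_itv /= => s01 sx.
    have s2 : s < 1 / 2.
      rewrite ltNge; apply/negP => h; apply: nCx; left; exists j => //; exists s => //=.
      by rewrite in_itv /=; lra.
    exists (enum_rank_in jP j) => //; exists (s * 2); first by rewrite /=
      in_itv /=; lra.
    by rewrite enum_rankK_in // mulfK.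
  rewrite in_itv /= => t01 tx; set j := enum_val i in tx.
  have jP : j \in P := enum_valP i.
  have [jS vj] := PP j jP; have [ej j0' jE _] := gmP j vj.
  have t2 : 0 <= t / 2 <= 1 by lra.
  have jx : (g j @` `[0, 1]) x by rewrite -jE; exists (t / 2) => //=; rewrite in_itv.
  split; first by rewrite HE; exists j.
  move=> [[l /= lP [s /=]]|[l /= nlv lx]].
    rewrite in_itv /= => s01 sx.
    have s01' : 0 <= s <= 1 by lra.
    have h : gm j (t / 2) = gm l s by rewrite tx sx.
    have [jl|jl] := eqVneq j l.
      rewrite -jl in h; have [_ ij _] := ej.
      have {}h : t / 2 = s by exact: ij.
      by have := half_lt1 t (andP t01).2; rewrite h ltNge (andP s01).1.
    have [ht hs] := meet _ _ _ _ jP lP jl t2 s01' h.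
    have t0 : t / 2 = 0 by case: ht => //; lra.
    have s1 : s = 1 by case: hs => //; lra.
    by apply: (gm1 l lP); rewrite -s1 -h t0 j0'.
  have [jl|jl] := eqVneq j l.
    by apply: nlv; rewrite -jl; exact: mem_vertex.
  case: (jx) (lx) => s' /=; rewrite in_itv /= => s'01 s'x [t' /=];
    rewrite in_itv /= => t'01 t'x.
  have h : g j s' = g l t' by rewrite s'x t'x.
  have [+ _] := edges_meet jl s'01 t'01 h; rewrite s'x.
  have [_ _ _ [_ jV]] := gmP j vj; move=> /jV; have [_ ij _] := ej.
  rewrite j0' => -[xv|x1]; first by apply: nlv; rewrite -xv.
  have h1 : 0 <= (1 : R) <= 1 by lra.
  have : t / 2 = 1 by apply: ij => //; rewrite tx.
  by lra.
Qed.

Lemma noend_branching (S : {set 'I_n}) (H : set G) y : noend g S ->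
  H = \bigcup_(j in [set j | j \in S]) (g j @` `[0, 1]) -> H y -> branching R H y.
Proof.
move=> nS HE; rewrite {1}HE => -[j /= jS jy].
have [vj|[c /=]] := mem_edgeP jy; first exact: (branching_vertex nS HE jS vj).
rewrite in_itv /= => c01 <-; apply: branching_inner => //.
by rewrite HE => x jx; exists j.
Qed.

End Branches.

(** * A circle from edges without free ends *)

Section Circles.
Variables (R : realType) (G : topologicalType) (n : nat) (g : 'I_n -> R -> G).
Hypotheses (hG : hausdorff_space G) (gg : graph_edges g).

Lemma continuous_concat (u v : R -> G) (c : R) : continuous u -> continuous v ->
  u c = v c ->
  continuous (fun t => if t <= c then u t else v t).
Proof.
move=> cu cv uv t; case: (ltgtP t c) => tc.
- move=> W; rewrite /= ltW // => /cu nW; apply: (@filterS2 _ (nbhs t)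
  _ _ _ _ _ nW (lt_nbhsl tc)) => s /= Ws sc.
  by rewrite ltW.
- move=> W; rewrite /= leNgt tc /= => /cv nW; apply: (@filterS2 _ (nbhs t)
  _ _ _ _ _ nW (lt_nbhsr tc)) => s /= Ws sc.
  by rewrite leNgt sc.
- rewrite tc => W; rewrite /= lexx => nW.
  have nW' : nbhs (v c) W by rewrite -uv.
  apply: (@filterS2 _ (nbhs c) _ _ _ _ _ (cu _ _ nW) (cv _ _ nW')) => s /= us vs.
  by case: ifP.
Qed.

Lemma noend_circle (S : {set 'I_n}) j0 : noend g S -> j0 \in S ->
  exists C : set G, @is_circle R G C.
Proof.
move=> nS j0S.
(* [al] runs along the edges in [T]; its last edge [ek] is the only one of them at
   [al 1] *)
pose trail (T : {set 'I_n}) := exists (al : R -> G) (ek : 'I_n),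
  [/\ continuous al,
      (forall s t, 0 <= s <= 1 -> 0 <= t <= 1 -> al s = al t -> s = t),
      al @` `[0, 1] = \bigcup_(j in [set j | j \in T]) (g j @` `[0, 1]),
      (ek \in T) && (T \subset S) &
      vertex_of g (al 1) ek /\
      (forall j, j \in T -> j != ek -> ~ (g j @` `[0, 1]) (al 1))].
have h0 : 0 <= (0 : R) <= 1 by lra.
have h1 : 0 <= (1 : R) <= 1 by lra.
suff main k : forall T, (#|~: T| < k)%N -> trail T -> exists C : set G,
  @is_circle R G C.
  apply: (main #|~: [set j0]%SET|.+1 [set j0]%SET) => //.
  have [cj ij _] := graph_edge hG gg j0.
  exists (g j0), j0; split => //.
  - apply/seteqP; split => [x jx|x [j /=]]; first by exists j0 => //=; rewrite inE.
    by rewrite inE => /eqP ->.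
  - by rewrite inE eqxx finset.sub1set.
  - by split; [right|move=> j; rewrite inE => /eqP ->; rewrite eqxx].
elim: k => // k IH T; rewrite ltnS =>
  Tk [al [ek [cal ial alE /andP[ekT TS] [vek nek]]]].
have [e [eS eek ve]] := nS ek (al 1) (fintype.subsetP TS _ ekT) vek.
have eT : e \notin T by apply/negP => /nek /(_ eek).
have vee := vertex_of_mem gg vek ve.
have [gm [egm gm0 gmE [gm1 gmV]]] := vertex_orient hG gg vee.
have [cgm igm _] := egm.
have meet (s t : R) : 0 <= s <= 1 -> 0 <= t <= 1 -> al s = gm t -> t = 0 \/ t = 1.
  move=> s01 t01 st.
  have : (al @` `[0, 1]) (al s) by exists s => //=; rewrite in_itv.
  rewrite alE => -[j /= jT [s' /=]]; rewrite in_itv /= => s'01 s's.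
  have : (g e @` `[0, 1]) (gm t) by rewrite -gmE; exists t => //=; rewrite in_itv.
  move=> [t' /=]; rewrite in_itv /= => t'01 t't.
  have je : j != e by apply/eqP => je; rewrite -je jT in eT.
  have h : g j s' = g e t' by rewrite s's t't.
  have [_] := edges_meet gg je s'01 t'01 h; rewrite t't => /gmV.
  by case=> /igm ht; [left|right]; exact: ht.
have [[s0 /=]|nal] := pselect ((al @` `[0, 1]) (gm 1)).
  rewrite in_itv /= => s001 s0E.
  have s01 : s0 != 1.
    by apply/eqP => s01; move: gm1; rewrite -s0E s01 eqxx.
  (* Both arcs run from [al 1 = gm 0] to [al s0 = gm 1]: the path backwards at speed [c], and the
     new edge. *)
  pose c := 1 - s0.
  have c0 : 0 < c by rewrite /c; lra.
  have cI (t : R) : 0 <= t <= 1 -> 0 <= 1 - c * t <= 1.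
    move=> t01; have ct0 : 0 <= c * t by nra.
    have ct1 : c * t <= 1 by rewrite /c; nra.
    lra.
  have bk (s t : R) : 0 <= s <= 1 -> 0 <= t <= 1 -> al (1 - c * s) = gm t ->
      s = t /\ (s = 0 \/ s = 1).
    move=> ss tt h; have [t0|t1] := meet _ _ (cI _ ss) tt h.
      have hs : 1 - c * s = 1 by apply: ial => //; [exact: cI|rewrite h t0].
      have : c * s = 0 by lra.
      by move/eqP; rewrite mulf_eq0 gt_eqF //= => /eqP ->; rewrite t0; split => //;
        left.
    have hs : 1 - c * s = s0 by apply: ial => //; [exact: cI|rewrite h t1 s0E].
    have {}hs : c * s = c * 1 by rewrite /c in hs *; lra.
    have -> : s = 1 by apply: (mulfI _ hs); rewrite gt_eqF.
    by rewrite t1; split => //; right.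
  have kb (s : R) : s = 0 \/ s = 1 -> al (1 - c * s) = gm s.
    by case=> ->; [rewrite mulr0 subr0 gm0|rewrite mulr1 /c opprB addrC subrK].
  pose beta (j : bool) t := if j then al (1 - c * t) else gm t.
  apply: (@two_arcs_circle R G beta hG).
    case=> //= t; apply: (@continuous_comp _ _ _ (fun t : R => 1 - c * t) al);
      last exact: cal.
    by apply: cvgB; [exact: cvg_cst|apply: cvgM; [exact: cvg_cst|exact: cvg_id]].
  case=> -[] s t ss tt /=; split.
  - move=> /ial h; have {}h : 1 - c * s = 1 - c * t by apply: h; exact: cI.
    have {}h : c * s = c * t by lra.
    by split; [apply: (mulfI _ h); rewrite gt_eqF|right; right].
  - by move=> [->].
  - by move=> /(bk _ _ ss tt) [-> [|]]; split => //; [left|right; left].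
  - by move=> [<- [|[|//]]] h; apply: kb; [left|right].
  - by move=> /esym /(bk _ _ tt ss) [-> [|]]; split => //; [left|right; left].
  - by move=> [-> [|[|//]]] h; apply/esym; apply: kb; [left|right].
  - by move=> /igm h; split; [exact: h|right; right].
  - by move=> [->].
(* The new edge is appended; its far end is off the old path, so [e] is the only edge of the longer
   trail there. *)
pose al' t := if t <= 1 / 2 then al (2 * t) else gm (2 * t - 1).
have half1 (t : R) : 0 <= t <= 1 -> t <= 1 / 2 -> 0 <= 2 * t <= 1 by lra.
have half2 (t : R) : 0 <= t <= 1 -> (t <= 1 / 2) = false -> 0 <= 2 * t - 1 <=
  1 /\ 2 * t - 1 != 0.
  by move=> t01 /negbT; rewrite -ltNge => t2; split; lra.
apply: (IH (e |: T)).
  have -> : ~: (e |: T) = (~: T) :\ e by apply/setP => j; rewrite !inE negb_or.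
  by move: Tk; rewrite (cardsD1 e (~: T)) inE eT.
have al'1 : al' 1 = gm 1.
  rewrite /al'; case: ifP => [h|_]; first by exfalso; lra.
  by congr gm; lra.
have ngm (s t : R) : 0 <= s <= 1 -> 0 <= t <= 1 -> t != 0 -> al s <> gm t.
  move=> s01 t01 t0 st; have [t0'|t1] := meet _ _ s01 t01 st;
    first by rewrite t0' eqxx in t0.
  by apply: nal; exists s; [rewrite /= in_itv|rewrite st t1].
exists al', e; split.
- apply: (@continuous_concat (fun t => al (2 * t)) (fun t => gm (2 * t - 1))).
  + move=> t; apply: (@continuous_comp _ _ _ (fun t : R => 2 * t) al); last exact: cal.
    by apply: cvgM; [exact: cvg_cst|exact: cvg_id].
  + move=> t; apply: (@continuous_comp _ _ _ (fun t : R => 2 * t - 1) gm);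
    last exact: cgm.
    by apply: cvgB; [apply: cvgM; [exact: cvg_cst|exact: cvg_id]|exact: cvg_cst].
  + have -> : 2 * (1 / 2) = 1 :> R by lra.
    by rewrite subrr gm0.
- move=> s t s01 t01; rewrite /al'; case: ifP => s2; case: ifP => t2.
  + by move=> /ial h; have {}h : 2 * s = 2 * t by [apply: h; exact: half1]; lra.
  + have [t2' t0] := half2 t t01 t2.
    by move=> /(ngm _ _ (half1 s s01 s2) t2' t0).
  + have [s2' s0] := half2 s s01 s2.
    by move=> /esym /(ngm _ _ (half1 t t01 t2) s2' s0).
  + have [s2' s0] := half2 s s01 s2; have [t2' t0] := half2 t t01 t2.
    by move=> /igm h; have {}h : 2 * s - 1 = 2 * t - 1 by [exact: h]; lra.
- apply/seteqP; split => [x [t /=]|x [j /=]].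
    rewrite in_itv /= => t01; rewrite /al'; case: ifP => t2 tx.
      have : (al @` `[0, 1]) x by exists (2 * t) => //=; rewrite in_itv /=;
        exact: half1.
      by rewrite alE => -[j /= jT jx]; exists j => //=; rewrite !inE jT orbT.
    exists e; first by rewrite /= !inE eqxx.
    suff : (gm @` `[0, 1]) x by rewrite gmE.
    exists (2 * t - 1) => //=; rewrite in_itv /=.
    by have [] := half2 t t01 t2.
  rewrite !inE => /orP[/eqP ->|jT jx].
    move=> ex; have : (gm @` `[0, 1]) x by rewrite gmE.
    move=> [t /=]; rewrite in_itv /= => t01 tx.
    exists ((t + 1) / 2); first by rewrite /= in_itv /=; lra.
    have E : 2 * ((t + 1) / 2) - 1 = t by lra.
    rewrite /al' E; case: ifP => // h; have t0 : t = 0 by lra.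
    have -> : 2 * ((t + 1) / 2) = 1 by lra.
    by rewrite -tx t0 gm0.
  have [t /=] : (al @` `[0, 1]) x by rewrite alE; exists j.
  rewrite in_itv /= => t01 tx; exists (t / 2); first by rewrite /= in_itv /=; lra.
  have E : 2 * (t / 2) = t by lra.
  by rewrite /al' E; case: ifP => // /negbT; rewrite -ltNge => h; exfalso; lra.
- rewrite !inE eqxx /=; apply/fintype.subsetP => j; rewrite !inE => /orP[/eqP -> //|].
  exact: (fintype.subsetP TS).
- rewrite al'1; split; first by apply/gmV; right.
  move=> j; rewrite !inE => /orP[/eqP ->|jT _ jx]; first by rewrite eqxx.
  by apply: nal; rewrite alE; exists j.
Qed.

End Circles.

(** * Unfolding the definitions, and the dichotomy *)

Lemma is_graph_edges (R : realType) (G : pseudoMetricType R) : is_graph G ->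
  exists (n : nat) (g : 'I_n -> R -> G), graph_edges g.
Proof.
move=> [_ [n [g [_ arc cov cross]]]].
pose c (t : R) := clamp 0 1 t.
have cI t : 0 <= c t <= 1 by apply: clamp_in.
have cK t : 0 <= t <= 1 -> c t = t by exact: clampK.
have gi i s t : 0 <= s <= 1 -> 0 <= t <= 1 -> g i s = g i t -> s = t.
  move=> s01 t01 st; have [k [_ _ gk _]] := arc i.
  by have [_ <-] := gk s s01; have [_ <-] := gk t t01; rewrite st.
exists n, (fun i t => g i (c t)); split.
- move=> i; have [k [cg _ _ _]] := arc i.
  exact: (within_continuous_comp_in cg (@clamp_continuous R 0 1) cI).
- by move=> i s t s01 t01; rewrite !cK //; exact: gi.
- move=> x; have : [set: G] x by [].
  rewrite cov => -[i _ [t t01 tx]]; exists i, t; last by rewrite cK.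
  by rewrite /= in_itv.
- move=> i j s t ij s01 t01; rewrite !cK // => st.
  have h0 : 0 <= (0 : R) <= 1 by rewrite lexx ler01.
  have h1 : 0 <= (1 : R) <= 1 by rewrite lexx ler01.
  have [|si tj] := cross i j ij (g i s); first by split; [exists s|exists t].
  rewrite st in tj.
  split.
    by case: si => /gi h; [left|right]; exact: h.
  by case: tj => /gi h; [left|right]; exact: h.
Qed.

Lemma branching_fibre (R : realType) (E B G : topologicalType) (p : E -> B) U pi kap
    (M : set E) (x : E) : chart p U pi kap -> continuous p -> U (p x) ->
  branching R [set y : G | M (kap (p x, y))] (pi x) ->
  branching R (M `&` p @^-1` [set p x]) x.
Proof.
move=> [oU cpi ckap kpi pik] cp Ux [m [beta [A [m2 [oA cb] b0 ker HA]]]].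
have kinj y y' : kap (p x, y) = kap (p x, y') -> y = y'.
  by move=> h; rewrite -(pik _ y Ux).2 h (pik _ _ Ux).2.
exists m, (fun j t => kap (p x, beta j t)), [set x' | U (p x') /\ A (pi x')];
  split => //.
- split.
    rewrite openE => x' [Ux' Ax']; apply: filterI.
      by apply: (cp x'); exact: open_nbhs_nbhs.
    by apply: (cpi x' Ux'); exact: open_nbhs_nbhs.
  move=> j t; apply: (@continuous_comp _ _ _ (fun t => (p x, beta j t)) kap);
    last exact: ckap.
  by apply: pair_continuous; [exact: cst_continuous|exact: cb].
- by move=> j; rewrite b0 kpi.
- by move=> i j s t s01 t01 /kinj; exact: ker.
- apply/seteqP; split => [x' [[Mx' /= px'] [Ux' Ax']]|x' [j _ [t t01 <-]]].
    have : ([set y : G | M (kap (p x, y))] `&` A) (pi x').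
      by split => //=; rewrite -px' kpi.
    by rewrite HA => -[j _ [t t01 tx']]; exists j => //; exists t => //;
      rewrite tx' -px' kpi.
  have : ([set y : G | M (kap (p x, y))] `&` A) (beta j t).
    by rewrite HA; exists j => //; exists t.
  move=> [Mb Ab]; have [pE piE] := pik (p x) (beta j t) Ux.
  by split; split => //=; rewrite ?pE ?piE.
Qed.

Theorem theoremA (R : realType) (E B G : pseudoMetricType R)
  (p : E -> B) (F : E -> E) (f : B -> B) (M : set E) :
  @graph_bundle R E B G p ->
  continuous F -> continuous f -> (forall x, p (F x) = f (p x)) ->
  minimal_map f ->
  minimal_set F M -> p @` M = [set: B] ->
  let A1 := closure (@End_set R E B p M) = M in
  let A2 := @End_set R E B p M = set0 in
  [/\ (A1 \/ A2) /\ ~ (A1 /\ A2),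
      A1 <-> nowhere_dense M,
      A2 <-> interior M !=set0 &
      @is_tree R G -> nowhere_dense M].
Proof.
move=> bdl cF cf pF mf mM pM A1 A2.
have charts := bundle_chart bdl.
have [[[hE cE] [hB cB]] graphG cp _ _] := bdl.
have hG : hausdorff_space G by case: graphG => -[].
have [n [g gg]] := is_graph_edges graphG.
have [cM [x0 Mx0] _ _] := mM.
have mf' : minimal_set f [set: B].
  split; [exact: closedT|by exists (p x0)|by []|].
  by move=> A cA A0 _ fA; exact: mf.
have EM : End_set R p M `<=` M by move=> x [].
(* Around a point of [M] outside the closure of the end-points, [M] is star-like in its fibres,
   which would force interior. *)
have nd_A1 : M° = set0 -> A1.
  move=> iM; apply/seteqP; split.
    by move=> x clx; apply: cM; exact: closureS clx.
  move=> x Mx W; rewrite nbhsE => -[V [oV Vx] VW].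
  apply: contrapT => EW.
  suff : M° !=set0 by rewrite iM => -[].
  apply: (star_interior_solid cE cB hB hG gg cp cF cf pF mf' mM pM charts oV).
    by exists x.
  move=> y My Vy; apply: contrapT => ny; apply: EW.
  by exists y; split; [split|exact: VW].
have good x : M° !=set0 -> exists (U : set B) (pi : E -> G) (kap : B * G -> E),
    [/\ chart p U pi kap, U (p x) & good_fibre g M kap (p x)].
  move=> iM; have [U [pi [kap [Ux ch]]]] := charts (p x).
  exists U, pi, kap; split => //.
  exact: (all_fibres cE hE cB hB hG gg cp cF cf pF mf' mM pM charts iM ch Ux).
have int_A2 : M° !=set0 -> A2.
  move=> iM; apply/seteqP; split => // x [Mx nx].
  have [U [pi [kap [ch Ux [nS cov]]]]] := good x iM.
  apply: nx; apply: branching_star_interior => //.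
  apply: (branching_fibre ch cp Ux); apply: (noend_branching hG gg nS).
    apply/seteqP; split => [y My|y [j /=]].
      by have [j jS jy] := cov y My; exists j.
    by rewrite inE => /asboolP; apply.
  by have [_ _ _ kpi _] := ch; rewrite /= kpi.
have ndE : nowhere_dense M <-> M° = set0 by rewrite /nowhere_dense -(closure_id M).1.
have A1_A2 : A1 -> A2 -> False.
  by rewrite /A1 /A2 => a1 a2; move: Mx0; rewrite -a1 a2 closure0.
(* The two implications start from complementary cases and end in incompatible conclusions, so both
   become equivalences. *)
have [iM|niM] := pselect (M° !=set0).
  have a2 := int_A2 iM.
  have nnd : ~ nowhere_dense M by move=> /ndE iM0; move: iM; rewrite iM0 => -[].
  split.
  - by split; [right|case].
  - by split=> [a1|/nnd //]; case: (A1_A2 a1 a2).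
  - by split.
  (* For a tree this case is void: the full edges of the fibre through [x0] would produce a circle
     in [G]. *)
  - move=> [_ nC]; exfalso; apply: nC.
    have [U [pi [kap [ch Ux [nS cov]]]]] := good x0 iM.
    have [|j jS _] := cov (pi x0); first by have [_ _ _ kpi _] := ch; rewrite kpi.
    exact: (noend_circle hG gg nS jS).
have iM : M° = set0 by apply: contrapT => /eqP/set0P.
have a1 := nd_A1 iM.
split.
- by split; [left|case].
- by split => // _; apply/ndE.
- by split=> [a2|//]; case: (A1_A2 a1 a2).
- by move=> _; apply/ndE.
Qed.
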